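(* Let $0<p\le\infty$, let $m$ be a positive integer, and let $f$ be an entire function on $\mathbb{C}$. Then $f\in F^{p,m}$ (that is, the $m$-th derivative $f^{(m)}$ belongs to $F^p$) if and only if the function $z\mapsto z^m f(z)$ belongs to $F^p$.
   Context: $dA$ is ordinary area (Lebesgue) measure on $\mathbb{C}$. For $0<p\le\infty$, the Fock space $F^p$ is the space of entire functions $f:\mathbb{C}\to\mathbb{C}$ such that $z\mapsto f(z)e^{-|z|^2/2}$ belongs to $L^p(\mathbb{C},dA)$. For a positive integer $m$, the Fock-Sobolev space $F^{p,m}$ is the space of entire functions $f$ such that the $m$-th order derivative $f^{(m)}$ belongs to $F^p$. *)

(* Defs.v *)
From HB Require Import structures.
From mathcomp Require Import all_boot all_order all_algebra complex.
From mathcomp Require Import all_classical all_reals all_analysis.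

Set Implicit Arguments.
Unset Strict Implicit.
Unset Printing Implicit Defensive.
Import Order.TTheory GRing.Theory Num.Theory.
Import ComplexField.
Import numFieldNormedType.Exports.

Local Open Scope classical_set_scope.
Local Open Scope complex_scope.
Local Open Scope ring_scope.

(* The complex plane as a normed space over itself: nbhs, derivable z 1 and
   f^`(n) on R[i] then refer to the modulus and to complex differentiation. *)
HB.instance Definition _ (R : rcfType) := NormedModule.copy R[i] R[i]^o.

(* R[i] carries no measurable structure, so dA lives on R * R, identified
   with R[i] through (x, y) |-> x +i* y. *)
Definition area (R : realType)
    : {measure set (measurableTypeR R * measurableTypeR R) -> \bar R} :=
  (lebesgue_measure \x lebesgue_measure)%E.

Definition of_plane (R : realType)
    (w : measurableTypeR R * measurableTypeR R) : R[i] := w.1 +i* w.2.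

(* For finite p, Lnorm is (\int |g|^p)^(1/p), also when p < 1; at +oo it is
   the essential supremum. *)
Definition Lp (R : realType) (p : \bar R) : set (R[i] -> R[i]) :=
  [set g | [/\ measurable_fun [set: measurableTypeR R * measurableTypeR R]
                 (fun w => complex.Re (g (of_plane w)) : measurableTypeR R),
               measurable_fun [set: measurableTypeR R * measurableTypeR R]
                 (fun w => complex.Im (g (of_plane w)) : measurableTypeR R)
             & finite_norm (@area R) p (fun w => Normc.normc (g (of_plane w)))]].

Definition entire (R : realType) (f : R[i] -> R[i]) :=
  forall z : R[i], derivable f z 1.

Definition Fock (R : realType) (p : \bar R) : set (R[i] -> R[i]) :=
  [set f | entire f /\
     Lp p (fun z => f z * (expR (- (Normc.normc z ^+ 2 / 2)))%:C)].

Definition Fock_Sobolev (R : realType) (p : \bar R) (m : nat) :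
    set (R[i] -> R[i]) :=
  [set f | entire f /\ Fock p (f^`(m))%classic].

(* Main.v *)
From HB Require Import structures.
Require Import Defs.
From mathcomp Require Import all_boot all_order all_algebra complex.
From mathcomp Require Import all_classical all_reals all_analysis.
From mathcomp Require Import measurable_realfun ess_sup_inf.
From mathcomp Require Import ring lra.

Set Implicit Arguments.
Unset Strict Implicit.
Unset Printing Implicit Defensive.

Import Order.TTheory GRing.Theory Num.Theory.
Import ComplexField.
Import numFieldNormedType.Exports.
Local Open Scope classical_set_scope.
Local Open Scope complex_scope.
Local Open Scope ring_scope.

(** Write [W_k z = (1 + |z|)^k exp (- |z|^2 / 2)].  The theorem follows from the
    case of one derivative: for g entire, [W_k g'] is in L^p if and only if
    [W_(k+1) g] is (weighted_finite_derive).  Applied m times to f, this says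
    that [f^(m)] is in the Fock space if and only if [W_m f] is in L^p, and
    outside the unit disc [(1 + |z|)^m] may be replaced by [|z|^m].

    Everything happens on discs of radius of order [1 / (1 + |z|)], where the
    Gaussian weight is constant up to a factor (fock_weight_compare).  From g to
    g', the Cauchy estimate on such a disc costs one factor [1 + |z|].  From g'
    to g, one compares [g z] with the values of g at points w at distance of
    order [c / |z|] from z on the side of the origin: the mean value inequality
    brings in g' with a gain of one power of [1 + |z|], and the weight at z is
    [exp (- c / 4)] times the weight at w, up to a constant.  For c large the
    contribution of the values [g w] is at most half of the quantity to be
    bounded, and is absorbed (weighted_pow_primitive_lty); absorption is
    legitimate on each disc of finite radius, with bounds independent of the
    radius.

    For finite p the pointwise estimates are turned into integral ones by the
    submean value inequality for [|g|^p], valid for every p > 0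
    (submean_value), and by Tonelli's theorem for averages over these discs
    (disc_kernel_int_le).  For p infinite they are used as they stand.

    The complex analysis is built from complex differentiability alone.  Goursat's
    bisection gives an entire function a primitive (entire_primitive); that
    primitive is twice differentiable, with no continuity known of its second
    derivative, and this is enough for the second derivative test to prove a
    maximum principle (punctured_disc_max).  Applied to difference quotients it gives the Cauchy
    estimates, which in turn make the derivative of an entire function entire
    (entire_derive1). *)

Local Notation Nc := Normc.normc.

(** * The complex plane through its real-valued modulus *)

Section PlaneTopology.
Context {R : realType}.
Implicit Types (z w h : R[i]) (r e : R).

Lemma normc_ge0 z : 0 <= Nc z.
Proof. by case: z => a b; exact: sqrtr_ge0. Qed.

Lemma normc_real r : Nc r%:C = `|r|.
Proof. by rewrite /Nc /= expr0n /= addr0 sqrtr_sqr. Qed.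

Lemma normc_distC z w : Nc (z - w) = Nc (w - z).
Proof. by rewrite -opprB normcN. Qed.

Lemma normcX z n : Nc (z ^+ n) = Nc z ^+ n.
Proof.
elim: n => [|n ih]; first by rewrite !expr0 Normc.normc1.
by rewrite !exprS Normc.normcM ih.
Qed.

Lemma normc_eq0 z : (Nc z == 0) = (z == 0).
Proof.
apply/eqP/eqP => [|->]; [exact: Normc.eq0_normc | exact: Normc.normc0].
Qed.

Lemma normc_gt0 z : (0 < Nc z) = (z != 0).
Proof. by rewrite lt_def normc_ge0 andbT normc_eq0. Qed.

Lemma Re_le_normc z : `|complex.Re z| <= Nc z.
Proof. by have := normc_ge_Re z; rewrite lecR. Qed.

Lemma Im_le_normc z : `|complex.Im z| <= Nc z.
Proof.
case: z => a b; rewrite /Nc /= -sqrtr_sqr ler_sqrt ?addr_ge0 ?sqr_ge0 //.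
by rewrite lerDr sqr_ge0.
Qed.

Lemma normc_le_ReIm z : Nc z <= `|complex.Re z| + `|complex.Im z|.
Proof.
case: z => a b; rewrite /Nc /= -[leRHS]ger0_norm ?addr_ge0 //.
rewrite -[leRHS]sqrtr_sqr ler_sqrt ?sqr_ge0 //.
rewrite sqrrD !real_normK ?num_real // addrAC lerDl.
by rewrite mulrn_wge0 // mulr_ge0.
Qed.

Lemma ler_normcB z w : Nc z - Nc w <= Nc (z - w).
Proof. by rewrite lerBlDr; have := le_normcD (z - w) w; rewrite subrK. Qed.

Lemma ler_dist_normc z w : `|Nc z - Nc w| <= Nc (z - w).
Proof.
by rewrite ler_norml ler_normcB andbT lerNl opprB normc_distC ler_normcB.
Qed.

Lemma normc_lt0c z (e : R[i]) : 0 < e -> (`|z| < e) = (Nc z < complex.Re e).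
Proof.
move=> e0; have [k ek] : exists k : R, e = k%:C.
  by exists (complex.Re e); rewrite RRe_real // gtr0_real.
by rewrite ek; rewrite -ltcR.
Qed.

Lemma normc_i : Nc ('i : R[i]) = 1.
Proof. by rewrite /Nc /= expr0n /= add0r expr1n sqrtr1. Qed.

Lemma normc_rotate z : exists2 c : R[i], Nc c = 1 & complex.Re (c * z) = Nc z.
Proof.
have [->|z0] := eqVneq z 0; first by exists 1; rewrite ?Normc.normc1 // mulr0 Normc.normc0.
have Nz0 : Nc z != 0 by rewrite normc_eq0.
exists (z^* / (Nc z)%:C).
  rewrite Normc.normcM Normc.normcV normc_real ger0_norm ?normc_ge0 //.
  have -> : Nc z^* = Nc z by case: (z) => x y; rewrite /Nc /= sqrrN.
  by rewrite divff.
rewrite mulrAC [z^* * z]mulrC -(sqr_normc z) -[`|z|]/((Nc z)%:C).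
by rewrite expr2 mulfK // fmorph_eq0.
Qed.

(** The norm of R[i] takes its values in R[i]; all estimates below are written
    with the real-valued modulus instead. *)
Lemma nbhs_normcP z (P : set R[i]) :
  nbhs z P <-> exists2 d : R, 0 < d & forall w, Nc (w - z) < d -> P w.
Proof.
split.
  move=> /nbhs_ballP [e /= e0 He]; exists (complex.Re e).
    by move: e0; rewrite ltcE => /andP [].
  by move=> w wd; apply: He; rewrite /ball /= distrC normc_lt0c.
move=> [d d0 Hd]; apply/nbhs_ballP; exists d%:C => /=; first by rewrite ltcR.
move=> w; rewrite /ball /= distrC normc_lt0c ?ltcR //= => wd.
exact: Hd.
Qed.

Lemma continuous_normcP (f : R[i] -> R[i]) z :
  {for z, continuous f} <-> forall e, 0 < e ->
    exists2 d : R, 0 < d & forall w, Nc (w - z) < d -> Nc (f w - f z) < e.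
Proof.
split=> [cf e e0|cf A /nbhs_normcP [e e0 HA]].
  have : nbhs (f z) [set y | Nc (y - f z) < e] by apply/nbhs_normcP; exists e.
  by move=> /cf /nbhs_normcP.
by apply/nbhs_normcP; have [d d0 Hd] := cf e e0; exists d => // w /Hd /HA.
Qed.

Lemma continuous_real_normcP (f : R[i] -> R) z :
  {for z, continuous f} <-> forall e, 0 < e ->
    exists2 d : R, 0 < d & forall w, Nc (w - z) < d -> `|f w - f z| < e.
Proof.
split=> [cf e e0|cf A /nbhs_ballP [e /= e0 HA]].
  have : nbhs (f z) [set y | `|y - f z| < e].
    by apply/nbhs_ballP; exists e => // y; rewrite /ball /= distrC.
  by move=> /cf /nbhs_normcP.
apply/nbhs_normcP; have [d d0 Hd] := cf e e0; exists d => // w /Hd fw.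
by apply: HA; rewrite /ball /= distrC.
Qed.

Lemma continuous_Re : continuous (@complex.Re R : R[i] -> R).
Proof.
move=> z; apply/continuous_real_normcP => e e0; exists e => // w.
by apply: le_lt_trans; rewrite -raddfB Re_le_normc.
Qed.

Lemma continuous_Im : continuous (@complex.Im R : R[i] -> R).
Proof.
move=> z; apply/continuous_real_normcP => e e0; exists e => // w.
by apply: le_lt_trans; rewrite -raddfB Im_le_normc.
Qed.

Lemma continuous_normc : continuous (fun z : R[i] => Nc z).
Proof.
move=> z; apply/continuous_real_normcP => e e0; exists e => // w.
by apply: le_lt_trans; exact: ler_dist_normc.
Qed.

Lemma continuous_normc_comp (g : R[i] -> R[i]) :
  continuous g -> continuous (fun z => Nc (g z)).
Proof.
by move=> cg z; apply: continuous_comp; [exact: cg|exact: continuous_normc].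
Qed.

Lemma continuous_dist z : continuous (fun w : R[i] => Nc (w - z)).
Proof.
apply: continuous_normc_comp => w.
by apply: (@continuousB _ R[i]); [exact: (fun x => x)|exact: cst_continuous].
Qed.

Lemma continuous_of_plane : continuous (fun w : R * R => w.1 +i* w.2 : R[i]).
Proof.
move=> [a b] A /nbhs_normcP [d d0 HA].
apply/nbhs_ballP; exists (d / 2) => /=; first by rewrite divr_gt0.
move=> [x y]; rewrite /ball /= /prod_ball /ball /= => -[ax ay].
apply: HA; apply: le_lt_trans (normc_le_ReIm _) _ => /=.
by rewrite [ltRHS](splitr d) ltrD // distrC.
Qed.

Lemma continuous_line (a b : R[i]) : continuous (fun t : R => a + t%:C * b).
Proof.
move=> t A /nbhs_normcP [d d0 HA].
have b1 : 0 < Nc b + 1 by rewrite ltr_wpDl // normc_ge0.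
apply/nbhs_ballP; exists (d / (Nc b + 1)) => /=; first by rewrite divr_gt0.
move=> s; rewrite /ball /= => st; apply: HA.
rewrite opprD addrACA subrr add0r -mulrBl -raddfB Normc.normcM normc_real.
rewrite distrC; move: st; rewrite ltr_pdivlMr //; apply: le_lt_trans.
by rewrite ler_wpM2l // lerDl.
Qed.

(** Compactness is that of a closed bounded part of the product plane, of which
    the closed disc is the image. *)
Lemma disc_max (u : R[i] -> R) z r : 0 <= r -> continuous u ->
  exists2 c, Nc (c - z) <= r & forall w, Nc (w - z) <= r -> u w <= u c.
Proof.
move=> r0 cu; pose op := fun w : R * R => w.1 +i* w.2 : R[i].
have cop : continuous op by exact: continuous_of_plane.
pose K := [set w : R * R | Nc (op w - z) <= r].
have cK : closed K.
  have -> : K = (fun w : R * R => Nc (op w - z)) @^-1` [set x | x <= r] by [].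
  apply: (@preimage_closed _ _ (fun w : R * R => Nc (op w - z))); last exact: closed_le.
  move=> w _; apply: (@continuous_comp _ _ _ (fun w : R * R => op w - z)).
    by apply: (@cvgB _ R[i]); [exact: cop|exact: cvg_cst].
  exact: continuous_normc.
pose a := complex.Re z; pose b := complex.Im z.
pose B := `[a - r, a + r] `*` `[b - r, b + r].
have KB : K `<=` B.
  move=> [x y]; rewrite /K /B /= !in_itv /= => Kxy; split.
    have := le_trans (Re_le_normc _) Kxy; rewrite raddfB /= -/a ler_norml.
    by rewrite lerBrDr lerBlDr addrC [r + a]addrC.
  have := le_trans (Im_le_normc _) Kxy; rewrite raddfB /= -/b ler_norml.
  by rewrite lerBrDr lerBlDr addrC [r + b]addrC.
have compK : compact K.
  by apply: (subclosed_compact cK _ KB); apply: compact_setX; exact: segment_compact.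
have K0 : K !=set0.
  exists (a, b); rewrite /K /op /=; have -> : a +i* b = z by rewrite /a /b; case: (z).
  by rewrite subrr Normc.normc0.
have cuop : continuous (u \o op).
  by move=> w; apply: continuous_comp; [exact: cop|exact: cu].
have [c] := compact_EVT_max K0 compK (continuous_subspaceT cuop).
rewrite inE => Kc maxc; exists (op c) => // w wz.
have := maxc (complex.Re w, complex.Im w).
by rewrite inE /K /op /=; case: w wz => x y /= wz; apply.
Qed.

Lemma disc_bounded (f : R[i] -> R[i]) z r : continuous f ->
  exists2 M : R, 0 < M & forall w, Nc (w - z) <= r -> Nc (f w) <= M.
Proof.
move=> cf; have [r0|r0] := leP 0 r; last first.
  by exists 1 => // w wz; have := normc_ge0 (w - z); rewrite leNgt (le_lt_trans wz).
have cNf := continuous_normc_comp cf.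
have [c _ maxc] := disc_max z r0 cNf.
exists (Nc (f c) + 1); first by rewrite ltr_wpDl // normc_ge0.
by move=> w /maxc /= /le_trans; apply; rewrite lerDl.
Qed.

(** In this form the zero increment needs no exception, and estimates on the
    increments of f can be used without dividing. *)
Lemma is_derive_normcP (f : R[i] -> R[i]) z d :
  is_derive z 1 f d <-> forall e, 0 < e -> exists2 r : R, 0 < r &
    forall h, Nc h < r -> Nc (f (z + h) - f z - d * h) <= e * Nc h.
Proof.
split=> [[df dE] e e0|H].
  move: df; rewrite /derivable -[lim _]/('D_1 f z) => /cvg_ex [l fl].
  have {}dE : l = d by rewrite -dE /derive (cvg_lim _ fl).
  have : nbhs d [set y | Nc (y - d) < e] by apply/nbhs_normcP; exists e.
  rewrite -{1}dE => /fl; rewrite /nbhs /= /dnbhs /= => /nbhs_normcP [r r0 Hr].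
  exists r => // h hr; have [->|h0] := eqVneq h 0.
    by rewrite addr0 subrr mulr0 subr0 Normc.normc0 mulr0.
  have := Hr h; rewrite subr0 => /(_ hr h0) /=.
  rewrite [h *: 1]mulr1 [h + z]addrC -[_ *: _]/(h^-1 * _) => /ltW.
  rewrite -(ler_pM2r (x := Nc h)) ?normc_gt0 // -Normc.normcM mulrBl.
  by rewrite mulrAC mulVf // mul1r.
suff fl : (fun h => h^-1 *: ((f \o shift z) (h *: 1) - f z)) @ 0^' --> d.
  by apply: DeriveDef; [apply/cvg_ex; exists d|exact: cvg_lim fl].
move=> A /nbhs_normcP [e e0 HA].
have [r r0 Hr] := H (e / 2) (divr_gt0 e0 (ltr0Sn _ 1)).
apply/nbhs_normcP; exists r => // h; rewrite subr0 => hr h0.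
apply: HA; rewrite /= [h *: 1]mulr1 [h + z]addrC -[_ *: _]/(h^-1 * _).
have hN0 : 0 < Nc h by rewrite normc_gt0.
rewrite -(ltr_pM2r hN0) -Normc.normcM mulrBl mulrAC mulVf // mul1r.
by apply: le_lt_trans (Hr _ hr) _; rewrite ltr_pM2r // ltr_pdivrMr // ltr_pMr // ltrDl.
Qed.

Lemma is_derive_continuous (f : R[i] -> R[i]) z d :
  is_derive z 1 f d -> {for z, continuous f}.
Proof.
by move=> [df _]; apply: differentiable_continuous; exact/derivable1_diffP.
Qed.

Lemma entire_is_derive (f : R[i] -> R[i]) : entire f ->
  forall z, is_derive z 1 f (f^`()%classic z).
Proof. by move=> ef z; rewrite derive1E; apply/derivableP; exact: ef. Qed.

Lemma entire_continuous (f : R[i] -> R[i]) : entire f -> continuous f.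
Proof. by move=> ef z; exact: is_derive_continuous (entire_is_derive ef z). Qed.

(** Real derivatives along a line inherit those of f; the factor c gives access
    to the imaginary part as well, and to rotations of the target. *)
Lemma is_derive_line (f : R[i] -> R[i]) a b c d (t : R) :
  is_derive (a + t%:C * b) 1 f d ->
  is_derive t 1 (fun s : R => complex.Re (c * f (a + s%:C * b)))
    (complex.Re (c * (d * b))).
Proof.
move=> /is_derive_normcP H.
pose g (s : R) := complex.Re (c * f (a + s%:C * b)).
suff fl : (fun h : R => h^-1 *: ((g \o shift t) (h *: 1) - g t)) @ 0^' -->
    complex.Re (c * (d * b)).
  by apply: DeriveDef; [apply/cvg_ex; eexists; exact: fl|exact: cvg_lim fl].
move=> A /nbhs_ballP [e /= e0 HA].
pose k := Nc c * Nc b + 1.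
have k0 : 0 < k by rewrite ltr_wpDl // mulr_ge0 // normc_ge0.
have b0 : 0 < Nc b + 1 by rewrite ltr_wpDl // normc_ge0.
have [r r0 Hr] := H (e / k) (divr_gt0 e0 k0).
apply/nbhs_ballP; exists (r / (Nc b + 1)) => /=; first by rewrite divr_gt0.
move=> h; rewrite /ball /= sub0r normrN => hr h0.
apply: HA; rewrite /ball /= distrC [h *: 1]mulr1 -[_ *: _]/(h^-1 * _).
have h0' : 0 < `|h| by rewrite normr_gt0.
rewrite -(ltr_pM2r h0') -normrM mulrBl mulrAC mulVf // mul1r /g.
rewrite -raddfB -mulrBr.
have -> : complex.Re (c * (d * b)) * h = complex.Re (c * (d * (h%:C * b))).
  by case: (c) (d) (b) => [c1 c2] [d1 d2] [b1 b2] /=; ring.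
rewrite -raddfB -mulrBr; apply: le_lt_trans (Re_le_normc _) _.
rewrite Normc.normcM.
have -> : a + (h + t)%:C * b = a + t%:C * b + h%:C * b.
  by rewrite [h + t]addrC raddfD mulrDl addrA.
have hb : Nc (h%:C * b) = `|h| * Nc b by rewrite Normc.normcM normc_real.
apply: le_lt_trans (ler_wpM2l (normc_ge0 c) (Hr _ _)) _.
  rewrite hb; move: hr; rewrite ltr_pdivlMr //; apply: le_lt_trans.
  by rewrite ler_wpM2l // lerDl.
rewrite hb (_ : Nc c * _ = (Nc c * Nc b) * (e / k) * `|h|); last by ring.
rewrite ltr_pM2r // mulrCA gtr_pMr // ltr_pdivrMr // mul1r.
by rewrite ltrDl.
Qed.

(** Mean value inequality along a segment: rotate the increment onto the
    positive real axis and apply the real mean value theorem. *)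
Lemma normc_MVT (f f' : R[i] -> R[i]) a b M :
  (forall t : R, 0 <= t <= 1 ->
     is_derive (a + t%:C * b) 1 f (f' (a + t%:C * b)) /\
     Nc (f' (a + t%:C * b)) <= M) ->
  Nc (f (a + b) - f a) <= M * Nc b.
Proof.
move=> H; set v := f (a + b) - f a.
have [->|v0] := eqVneq v 0.
  rewrite Normc.normc0 mulr_ge0 ?normc_ge0 //.
  have [] := H 0; first by rewrite lexx ler01.
  by move=> _; apply: le_trans; exact: normc_ge0.
have [c Nc1 cv] := normc_rotate v.
have [|| t t01 E] := @MVT_segment R (fun s : R => complex.Re (c * f (a + s%:C * b)))
    (fun s => complex.Re (c * (f' (a + s%:C * b) * b))) 0 1 ler01.
- move=> s; rewrite in_itv /= => /andP [s0 s1]; apply: is_derive_line.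
  by have [] := H s; rewrite ?(ltW s0) ?(ltW s1).
- apply: derivable_within_continuous => s; rewrite in_itv /= => s01.
  have [ds _] := H s s01.
  by have [] := @is_derive_line _ _ _ c _ _ ds.
move: E; rewrite subr0 mulr1 rmorph1 rmorph0 mul1r mul0r addr0 -raddfB -mulrBr.
rewrite -/v [LHS]cv => ->; apply: le_trans (ler_norm _) _.
apply: le_trans (Re_le_normc _) _; rewrite Normc.normcM [X in X * _]Nc1 mul1r Normc.normcM.
rewrite ler_wpM2r ?normc_ge0 //.
by have [] := H t; first by move: t01; rewrite in_itv.
Qed.

End PlaneTopology.

(** * Primitives on the real line *)

Section Primitives.
Context {R : realType}.
Implicit Types (x y t : R).

Lemma real_MVT_le (G g : R -> R) (a b M : R) :
  (forall s, a <= s <= b \/ b <= s <= a -> is_derive s 1 G (g s) /\ `|g s| <= M) ->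
  `|G b - G a| <= M * `|b - a|.
Proof.
wlog ab : a b / a <= b.
  move=> W H; have [/W|/ltW /W] := leP a b; first exact.
  by rewrite distrC [`|b - a|]distrC; apply => s [] sab; apply: H; [right|left].
move=> H; have [||c cab ->] := @MVT_segment R G g a b ab.
- by move=> s; rewrite in_itv /= => /andP [s0 s1]; case: (H s); rewrite ?(ltW s0) ?(ltW s1) //; left.
- apply: derivable_within_continuous => s; rewrite in_itv /= => sab.
  by have [[]] := H s (or_introl sab).
rewrite normrM ler_wpM2r //; move: cab; rewrite in_itv /= => cab.
by have [] := H c (or_introl cab).
Qed.

(** Integrating from [- n] gives a primitive to the right of [- n]; normalised at
    0, these primitives agree where they are all defined, hence glue. *)
Lemma continuous_primitive (g : R -> R) : continuous g ->
  exists G : R -> R, forall x, is_derive x 1 G (g x).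
Proof.
move=> cg.
have loc (n : nat) : exists G : R -> R, G 0 = 0 /\
    forall x, - n.+1%:R < x -> is_derive x 1 G (g x).
  pose F x := \int[lebesgue_measure]_(t in `[(- n.+1%:R), x]) g t.
  exists (fun x => F x - F 0); split; first by rewrite subrr.
  move=> x nx; have ig : lebesgue_measure.-integrable `[- n.+1%:R, x + 1] (EFin \o g).
    apply: continuous_compact_integrable; first exact: segment_compact.
    exact: continuous_subspaceT.
  have xx1 : x < x + 1 by rewrite ltrDl.
  have [dF F'] := continuous_FTC1_closed xx1 ig nx (cg x).
  have : is_derive x 1 F (g x) by rewrite -F' derive1E; exact/derivableP.
  move=> dFx; have -> : (fun y => F y - F 0) = F - cst (F 0) by [].
  by apply: is_derive_eq; rewrite subr0.
have [G HG] := boolp.choice loc.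
have G0 n : G n 0 = 0 by case: (HG n).
have dG n x : - n.+1%:R < x -> is_derive x 1 (G n) (g x) by case: (HG n) => _; exact.
have GE n m x : (n <= m)%N -> - n.+1%:R < x -> G n x = G m x.
  move=> nm nx; apply/eqP; rewrite -subr_eq0 -normr_le0.
  have := @real_MVT_le (G n - G m) (fun=> 0) 0 x 0; rewrite mul0r.
  rewrite -![(G n - G m) _]/(G n _ - G m _) !G0 !subr0; apply => s s0x.
  have ns : - n.+1%:R < s.
    by case: s0x => /andP [s1 s2]; [rewrite (lt_le_trans _ s1) // oppr_lt0|rewrite (lt_le_trans nx)].
  have ms : - m.+1%:R < s by apply: le_lt_trans ns; rewrite lerN2 ler_nat.
  split; last by rewrite normr0.
  have ? := dG _ _ ns; have ? := dG _ _ ms.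
  by apply: is_derive_eq; rewrite subrr.
pose k x := Num.trunc `|x|.
have kx x : - (k x).+1%:R < x.
  rewrite ltrNl; apply: le_lt_trans (truncnS_gt _).
  by rewrite -normrN ler_norm.
exists (fun x => G (k x) x) => x.
apply: (@near_eq_is_derive _ _ _ (G (k x))); last exact: dG.
have d0 : 0 < (k x).+1%:R - `|x| by rewrite subr_gt0 truncnS_gt.
apply/nbhs_ballP; exists ((k x).+1%:R - `|x|) => //= y; rewrite /ball /= => xy.
apply/esym/GE => //; rewrite -ltnS -(ltr_nat R).
apply: (@le_lt_trans _ _ `|y|); first by rewrite truncn_le.
rewrite ltrBrDr in xy; apply: le_lt_trans xy.
by rewrite addrC -lerBlDl distrC lerB_dist.
Qed.
End Primitives.

(** * Goursat's theorem and primitives of entire functions *)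

Section Goursat.
Context {R : realType}.
Implicit Types (a b c d x y t w h : R) (z : R[i]).

(** Componentwise, because R[i] is taken as a normed module over itself and not
    over R. *)
Definition is_derive_curve (G : R -> R[i]) (t : R) (v : R[i]) :=
  is_derive t 1 (fun s => complex.Re (G s)) (complex.Re v) /\
  is_derive t 1 (fun s => complex.Im (G s)) (complex.Im v).

Lemma is_derive_curve_line (f : R[i] -> R[i]) z v v' t :
  is_derive (z + t%:C * v) 1 f v' ->
  is_derive_curve (fun s => f (z + s%:C * v)) t (v' * v).
Proof.
move=> df; split; first by have := is_derive_line 1 df; under eq_fun do rewrite mul1r; rewrite mul1r.
have ImE (u : R[i]) : complex.Im u = complex.Re (- 'i * u) by case: u => p q /=; ring.
by under eq_fun do rewrite ImE; rewrite ImE; exact: is_derive_line.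
Qed.

Lemma curve_primitive (g : R -> R[i]) : continuous g ->
  exists G : R -> R[i], forall t, is_derive_curve G t (g t).
Proof.
move=> cg.
have [G1 dG1] : exists G1 : R -> R, forall x, is_derive x 1 G1 (complex.Re (g x)).
  apply: continuous_primitive => x.
  by apply: (@continuous_comp _ _ _ g); [exact: cg|exact: continuous_Re].
have [G2 dG2] : exists G2 : R -> R, forall x, is_derive x 1 G2 (complex.Im (g x)).
  apply: continuous_primitive => x.
  by apply: (@continuous_comp _ _ _ g); [exact: cg|exact: continuous_Im].
by exists (fun x => G1 x +i* G2 x) => t; split => /=.
Qed.

Lemma curve_MVT (G1 G2 g1 g2 : R -> R[i]) (a b M : R) :
  (forall s, a <= s <= b \/ b <= s <= a ->
    [/\ is_derive_curve G1 s (g1 s), is_derive_curve G2 s (g2 s)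
      & Nc (g1 s - g2 s) <= M]) ->
  Nc ((G1 b - G1 a) - (G2 b - G2 a)) <= 2 * M * `|b - a|.
Proof.
move=> H; apply: le_trans (normc_le_ReIm _) _; rewrite -mulrA mulrDl mul1r.
have ReE (u v u' v' : R[i]) : complex.Re (u - v - (u' - v')) =
    (complex.Re u - complex.Re u') - (complex.Re v - complex.Re v').
  by case: u v u' v' => [? ?] [? ?] [? ?] [? ?] /=; ring.
have ImE (u v u' v' : R[i]) : complex.Im (u - v - (u' - v')) =
    (complex.Im u - complex.Im u') - (complex.Im v - complex.Im v').
  by case: u v u' v' => [? ?] [? ?] [? ?] [? ?] /=; ring.
rewrite ReE ImE; apply: lerD.
  apply: (@real_MVT_le _ (fun s => complex.Re (G1 s) - complex.Re (G2 s))
    (fun s => complex.Re (g1 s) - complex.Re (g2 s))) => s /H [[d1 _] [d2 _] le12].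
  split; first exact: is_deriveB.
  by rewrite -raddfB; apply: le_trans le12; exact: Re_le_normc.
apply: (@real_MVT_le _ (fun s => complex.Im (G1 s) - complex.Im (G2 s))
  (fun s => complex.Im (g1 s) - complex.Im (g2 s))) => s /H [[_ d1] [_ d2] le12].
split; first exact: is_deriveB.
by rewrite -raddfB; apply: le_trans le12; exact: Im_le_normc.
Qed.

Variables (f : R[i] -> R[i]) (H V : R -> R -> R[i]).
Hypothesis ef : entire f.
Hypothesis dH : forall y x, is_derive_curve (H y) x (f (x +i* y)).
Hypothesis dV : forall x y, is_derive_curve (V x) y (f (x +i* y) * 'i).

(** The integral of f around the rectangle with opposite corners (a, c) and
    (b, d).  Writing it with primitives H and V along horizontal and vertical
    lines makes its additivity under subdivision a polynomial identity. *)
Let contour a b c d :=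
  (H c b - H c a) + (V b d - V b c) - (H d b - H d a) - (V a d - V a c).

(** Affine functions have a primitive on the whole plane, whose contributions to
    the four sides cancel; only the distance of f to the affine function is
    left. *)
Lemma contour_affine_le a b c d (u v : R[i]) M : a <= b -> c <= d ->
  (forall x y, a <= x <= b -> c <= y <= d ->
     Nc (f (x +i* y) - (u + v * (x +i* y))) <= M) ->
  Nc (contour a b c d) <= 4 * M * ((b - a) + (d - c)).
Proof.
move=> ab cd fM; pose A z := u * z + v / 2 * (z * z).
have dA z : is_derive z 1 A (u + v * z).
  have dz : is_derive z 1 (@id R[i]) 1 by exact: is_derive_id.
  have dzz : is_derive z 1 (@id R[i] * @id R[i]) (z *: 1 + z *: 1) by exact: is_deriveM.
  have -> : A = u *: @id R[i] + (v / 2) *: (@id R[i] * @id R[i]) by [].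
  apply: (is_derive_eq (is_deriveD (is_deriveZ u dz) (is_deriveZ (v / 2) dzz))).
  rewrite -[u *: 1]/(u * 1) -[z *: 1]/(z * 1) -[(v / 2) *: _]/((v / 2) * _) !mulr1.
  by field.
have dAh y x : is_derive_curve (fun s => A (s +i* y)) x (u + v * (x +i* y)).
  have E s : s +i* y = (0 +i* y) + s%:C * 1 by rewrite mulr1; apply/eqP; rewrite eq_complex /= add0r addr0 !eqxx.
  have := is_derive_curve_line (dA ((0 +i* y) + x%:C * 1)).
  by rewrite -E mulr1; under eq_fun do rewrite -E.
have dAv x y : is_derive_curve (fun s => A (x +i* s)) y ((u + v * (x +i* y)) * 'i).
  have E s : x +i* s = (x +i* 0) + s%:C * 'i.
    by apply/eqP; rewrite eq_complex /=; apply/andP; split; apply/eqP; ring.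
  have := is_derive_curve_line (dA ((x +i* 0) + y%:C * 'i)).
  by rewrite -E; under eq_fun do rewrite -E.
have hH y : c <= y <= d ->
    Nc ((H y b - H y a) - (A (b +i* y) - A (a +i* y))) <= 2 * M * (b - a).
  move=> cyd; rewrite -[b - a]ger0_norm ?subr_ge0 //.
  apply: (curve_MVT (G2 := fun s => A (s +i* y)) (g2 := fun s => u + v * (s +i* y))
    (g1 := fun s => f (s +i* y))) => s abs; split => //.
  apply: fM => //; case: abs => [//|/andP [s1 s2]].
  by rewrite (le_trans ab s1) (le_trans s2 ab).
have hV x : a <= x <= b ->
    Nc ((V x d - V x c) - (A (x +i* d) - A (x +i* c))) <= 2 * M * (d - c).
  move=> axb; rewrite -[d - c]ger0_norm ?subr_ge0 //.
  apply: (curve_MVT (G2 := fun s => A (x +i* s)) (g2 := fun s => (u + v * (x +i* s)) * 'i)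
    (g1 := fun s => f (x +i* s) * 'i)) => s abs; split => //.
  rewrite -mulrBl Normc.normcM normc_i mulr1; apply: fM => //; case: abs => [//|/andP [s1 s2]].
  by rewrite (le_trans cd s1) (le_trans s2 cd).
have -> : contour a b c d =
    ((H c b - H c a) - (A (b +i* c) - A (a +i* c))) +
    ((V b d - V b c) - (A (b +i* d) - A (b +i* c))) +
    - ((H d b - H d a) - (A (b +i* d) - A (a +i* d))) +
    - ((V a d - V a c) - (A (a +i* d) - A (a +i* c))).
  by rewrite /contour; ring.
have := hH c; have := hH d; have := hV a; have := hV b.
rewrite !lexx ab cd /= => /(_ isT) h1 /(_ isT) h2 /(_ isT) h3 /(_ isT) h4.
apply: le_trans (le_normcD _ _) _; rewrite normcN.
apply: le_trans (lerD (le_normcD _ _) h2) _; rewrite normcN.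
apply: le_trans (lerD (lerD (le_normcD _ _) h3) (lexx _)) _.
apply: le_trans (lerD (lerD (lerD h4 h1) (lexx _)) (lexx _)) _.
by rewrite le_eqVlt; apply/orP; left; apply/eqP; ring.
Qed.

(** Goursat's bisection: one quarter of a rectangle carries at least a quarter
    of its contour integral; at the limit point the affine expansion of f
    makes the contour integral small compared with the area. *)
Lemma contour_eq0_le a b c d : a <= b -> c <= d -> contour a b c d = 0.
Proof.
move=> ab cd; apply/eqP; rewrite -normc_eq0; apply/eqP.
set K := Nc _; apply/eqP; rewrite eq_le normc_ge0 andbT leNgt; apply/negP => K0.
set w := b - a; set h := d - c.
have w0 : 0 <= w by rewrite subr_ge0.
have h0 : 0 <= h by rewrite subr_ge0.
pose J n (p : R * R) := contour p.1 (p.1 + w / 2 ^+ n) p.2 (p.2 + h / 2 ^+ n).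
pose bad n p := K / 4 ^+ n <= Nc (J n p).
pose near_corner n (p q : R * R) :=
  (q.1 = p.1 \/ q.1 = p.1 + w / 2 ^+ n.+1) /\ (q.2 = p.2 \/ q.2 = p.2 + h / 2 ^+ n.+1).
have step n p : exists q, near_corner n p q /\ (bad n p -> bad n.+1 q).
  have [bp|] := pselect (bad n p); last by exists p; split => //; split; left.
  apply: contrapT => /forallNP no.
  have small q : near_corner n p q -> Nc (J n.+1 q) < K / 4 ^+ n.+1.
    by move=> pq; rewrite ltNge; apply/negP => bq; apply: (no q); split.
  set w' := w / 2 ^+ n.+1; set h' := h / 2 ^+ n.+1.
  have ww : w / 2 ^+ n = w' + w'.
    by rewrite /w' exprS invfM; field; rewrite expf_neq0.
  have hh : h / 2 ^+ n = h' + h'.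
    by rewrite /h' exprS invfM; field; rewrite expf_neq0.
  have s1 := small (p.1, p.2) (conj (or_introl erefl) (or_introl erefl)).
  have s2 := small (p.1 + w', p.2) (conj (or_intror erefl) (or_introl erefl)).
  have s3 := small (p.1, p.2 + h') (conj (or_introl erefl) (or_intror erefl)).
  have s4 := small (p.1 + w', p.2 + h') (conj (or_intror erefl) (or_intror erefl)).
  move: bp; apply/negP; rewrite /bad -ltNge.
  have -> : J n p = J n.+1 (p.1, p.2) + J n.+1 (p.1 + w', p.2) +
      J n.+1 (p.1, p.2 + h') + J n.+1 (p.1 + w', p.2 + h').
    by rewrite /J /contour ww hh -/w' -/h' /= !addrA; ring.
  have -> : K / 4 ^+ n = K / 4 ^+ n.+1 + K / 4 ^+ n.+1 + K / 4 ^+ n.+1 + K / 4 ^+ n.+1.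
    by rewrite exprS; field; rewrite expf_neq0.
  apply: le_lt_trans (le_normcD _ _) _; apply: ltrD => //.
  apply: le_lt_trans (le_normcD _ _) _; apply: ltrD => //.
  by apply: le_lt_trans (le_normcD _ _) _; apply: ltrD.
pose next n := projT1 (boolp.choice (step n)).
have Hnext n : forall q, near_corner n q (next n q) /\ (bad n q -> bad n.+1 (next n q)).
  exact: projT2 (boolp.choice (step n)).
pose p := fix p n := if n is m.+1 then next m (p m) else (a, c).
have bads n : bad n (p n).
  elim: n => [|n ih]; last by have [_] := Hnext n (p n); exact.
  rewrite /bad /J /= !expr0 !divr1 /w /h.
  by rewrite ![_ + (_ - _)]addrC !subrK.
(* The intervals [u n, u n + l / 2^n] are nested; their common point is the
   supremum of the left endpoints. *)
have nested (u : nat -> R) (l : R) : 0 <= l ->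
    (forall n, u n.+1 = u n \/ u n.+1 = u n + l / 2 ^+ n.+1) ->
    exists t, forall n, u n <= t <= u n + l / 2 ^+ n.
  move=> l0 Hu.
  have ll n : l / 2 ^+ n = l / 2 ^+ n.+1 + l / 2 ^+ n.+1.
    by rewrite exprS invfM; field; rewrite expf_neq0.
  have l0n n : 0 <= l / 2 ^+ n by rewrite divr_ge0 // exprn_ge0.
  have incr : {homo u : n m / (n <= m)%N >-> n <= m}.
    apply: homo_leq; [exact: lexx|exact: le_trans|move=> n].
    by case: (Hu n) => ->; rewrite ?lexx // lerDl.
  have decr : {homo (fun n => u n + l / 2 ^+ n) : n m / (n <= m)%N >-> m <= n}.
    apply: homo_leq; [exact: lexx|by move=> ? ? ? /[swap]; exact: le_trans|move=> n].
    rewrite (ll n); case: (Hu n) => ->; last by rewrite addrA.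
    by rewrite lerD2l lerDl.
  have ub m : ubound (range u) (u m + l / 2 ^+ m).
    move=> _ [n _ <-]; apply: le_trans (incr n _ (leq_maxl n m)) _.
    apply: le_trans (decr m _ (leq_maxr n m)).
    by rewrite lerDl.
  exists (sup (range u)) => n; apply/andP; split.
    by apply: ub_le_sup; [exists (u 0%N + l / 2 ^+ 0)|exists n].
  by apply: sup_le_ub => //; exists (u 0%N); exists 0%N.
have [x Hx] := nested (fun n => (p n).1) w w0 (fun n => (Hnext n (p n)).1.1).
have [y Hy] := nested (fun n => (p n).2) h h0 (fun n => (Hnext n (p n)).1.2).
pose D := (w + h) ^+ 2 + 1.
have D0 : 0 < D by rewrite ltr_wpDl // sqr_ge0.
(* With an error e times the diameter in the affine expansion, the contour
   integral of the n-th rectangle is at most 4 e (w + h)^2 / 4^n, which this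
   choice keeps below K / 4^n. *)
pose e := K / (8 * D).
have e0 : 0 < e by rewrite divr_gt0 // mulr_gt0.
have /is_derive_normcP/(_ _ e0) [r r0 Hr] := entire_is_derive ef (x +i* y).
set f' := f^`()%classic _ in Hr.
pose n := Num.bound ((w + h) / r).
have Tn : (0 : R) < 2 ^+ n by rewrite exprn_gt0.
have nr : (w + h) / 2 ^+ n < r.
  rewrite ltr_pdivrMr // mulrC -ltr_pdivrMr //.
  by apply: upper_nthrootP.
have wn0 : 0 <= w / 2 ^+ n by rewrite divr_ge0 // exprn_ge0.
have hn0 : 0 <= h / 2 ^+ n by rewrite divr_ge0 // exprn_ge0.
have : Nc (J n (p n)) <= 4 * (e * ((w + h) / 2 ^+ n)) * (w / 2 ^+ n + h / 2 ^+ n).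
  have -> : w / 2 ^+ n + h / 2 ^+ n =
      ((p n).1 + w / 2 ^+ n - (p n).1) + ((p n).2 + h / 2 ^+ n - (p n).2) by ring.
  apply: (@contour_affine_le _ _ _ _ (f (x +i* y) - f' * (x +i* y)) f'); rewrite ?lerDl //.
  move=> s t ps pt; pose k := (s +i* t) - (x +i* y) : R[i].
  have kb : Nc k <= (w + h) / 2 ^+ n.
    apply: le_trans (normc_le_ReIm _) _; rewrite /k mulrDl /=.
    have dist q l u v : q <= u <= q + l -> q <= v <= q + l -> `|u - v| <= l :> R.
      by move=> /andP [? ?] /andP [? ?]; rewrite ler_norml; apply/andP; split; lra.
    by apply: lerD; [apply: dist ps (Hx n)|apply: dist pt (Hy n)].
  have := Hr k (le_lt_trans kb nr).
  rewrite [_ + k]addrC /k subrK -/k.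
  have -> : f (s +i* t) - (f (x +i* y) - f' * (x +i* y) + f' * (s +i* t)) =
      f (s +i* t) - f (x +i* y) - f' * k by rewrite /k; ring.
  by move=> /le_trans; apply; rewrite ler_pM2l.
move=> /(le_trans (bads n)); apply/negP; rewrite -ltNge.
have -> : 4 * (e * ((w + h) / 2 ^+ n)) * (w / 2 ^+ n + h / 2 ^+ n) =
   (K / 4 ^+ n) * ((w + h) ^+ 2 / (2 * D)).
  rewrite /e (_ : 4 ^+ n = 2 ^+ n * 2 ^+ n); last by rewrite -exprMn -natrM.
  by field; rewrite (gt_eqF D0) expf_neq0.
rewrite gtr_pMr ?divr_gt0 ?exprn_gt0 // ltr_pdivrMr ?mulr_gt0 // mul1r.
have := sqr_ge0 (w + h); rewrite /D; lra.
Qed.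

Lemma contour_eq0 a b c d : contour a b c d = 0.
Proof.
wlog ab : a b / a <= b => [W|].
  have [/W //|/ltW /W Wba] := leP a b.
  by rewrite -[RHS]oppr0 -Wba /contour; ring.
have [/(contour_eq0_le ab) //|/ltW /(contour_eq0_le ab) W] := leP c d.
by rewrite -[RHS]oppr0 -W /contour; ring.
Qed.

(** The function integrates f along the real axis and then vertically; since
    contour integrals vanish, its increments can be computed along any other
    broken line, here a horizontal and a vertical step from z. *)
Lemma contour_primitive z :
  is_derive z 1
    (fun s => H 0 (complex.Re s) + (V (complex.Re s) (complex.Im s) - V (complex.Re s) 0))
    (f z).
Proof.
apply/is_derive_normcP => e e0.
have e40 : 0 < e / 4 by rewrite divr_gt0.
have [r r0 Hr] := (continuous_normcP f z).1 (@entire_continuous _ f ef z) _ e40.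
exists r => // k kr; move: z k kr Hr => [x y] [u v] /= kr Hr.
have -> : H 0 (x + u) + (V (x + u) (y + v) - V (x + u) 0) - (H 0 x + (V x y - V x 0)) -
    f (x +i* y) * (u +i* v) =
  (H y (x + u) - H y x - f (x +i* y) * u%:C) +
  (V (x + u) (y + v) - V (x + u) y - f (x +i* y) * 'i * v%:C).
  have E : u +i* v = u%:C + 'i * v%:C.
    by apply/eqP; rewrite eq_complex /=; apply/andP; split; apply/eqP; ring.
  apply/eqP; rewrite E -subr_eq0 -(contour_eq0 x (x + u) 0 y) /contour.
  by apply/eqP; ring.
have lin (q : R[i]) (s : R) : is_derive_curve (fun s : R => q * s%:C) s q.
  have dq : is_derive (0 + s%:C * 1) 1 (q *: @id R[i]) q.
    exact: (is_derive_eq (is_deriveZ q (is_derive_id _ _)) (mulr1 q)).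
  have := is_derive_curve_line dq; rewrite mulr1; congr (is_derive_curve _ _ _).
  by apply/funext => t; rewrite add0r mulr1.
have uk : `|u| <= Nc (u +i* v) by exact: (Re_le_normc (u +i* v)).
have vk : `|v| <= Nc (u +i* v) by exact: (Im_le_normc (u +i* v)).
have -> : e * Nc (u +i* v) = 2 * (e / 4) * Nc (u +i* v) + 2 * (e / 4) * Nc (u +i* v) by field.
have h1 : Nc (H y (x + u) - H y x - f (x +i* y) * u%:C) <= 2 * (e / 4) * `|u|.
  have := @curve_MVT (H y) (fun s : R => f (x +i* y) * s%:C) (fun s => f (s +i* y))
    (fun=> f (x +i* y)) x (x + u) (e / 4).
  have -> : f (x +i* y) * (x + u)%:C - f (x +i* y) * x%:C = f (x +i* y) * u%:C.
    by rewrite -mulrBr -raddfB addrAC subrr add0r.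
  have -> : x + u - x = u by ring.
  apply => s xs; split => //; apply/ltW/Hr.
  apply: le_lt_trans kr; apply: le_trans uk.
  apply: le_trans (normc_le_ReIm _) _; rewrite /= subrr normr0 addr0.
  case: xs => /andP [s1 s2].
    by rewrite ger0_norm ?subr_ge0 // (le_trans _ (ler_norm _)) // lerBlDl.
  by rewrite ler0_norm ?subr_le0 // -normrN (le_trans _ (ler_norm _)) // lerN2 lerBrDl.
have h2 : Nc (V (x + u) (y + v) - V (x + u) y - f (x +i* y) * 'i * v%:C) <= 2 * (e / 4) * `|v|.
  have := @curve_MVT (V (x + u)) (fun s : R => f (x +i* y) * 'i * s%:C)
    (fun s => f ((x + u) +i* s) * 'i) (fun=> f (x +i* y) * 'i) y (y + v) (e / 4).
  have -> : f (x +i* y) * 'i * (y + v)%:C - f (x +i* y) * 'i * y%:C = f (x +i* y) * 'i * v%:C.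
    by rewrite -mulrBr -raddfB addrAC subrr add0r.
  have -> : y + v - y = v by ring.
  apply => s ys; split => //.
  rewrite -mulrBl Normc.normcM normc_i mulr1; apply/ltW/Hr.
  apply: le_lt_trans kr.
  have sv : `|s - y| <= `|v|.
    case: ys => /andP [s1 s2].
      by rewrite ger0_norm ?subr_ge0 // (le_trans _ (ler_norm _)) // lerBlDl.
    by rewrite ler0_norm ?subr_le0 // -normrN (le_trans _ (ler_norm _)) // lerN2 lerBrDl.
  rewrite /Nc /= ler_sqrt ?addr_ge0 ?sqr_ge0 // addrAC subrr add0r lerD2l.
  by rewrite -[leLHS]real_normK ?num_real // -[leRHS]real_normK ?num_real // lerXn2r.
apply: le_trans (le_normcD _ _) _; apply: lerD.
  by apply: le_trans h1 _; rewrite ler_pM2l ?mulr_gt0.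
by apply: le_trans h2 _; rewrite ler_pM2l ?mulr_gt0.
Qed.

End Goursat.

Lemma entire_primitive (R : realType) (f : R[i] -> R[i]) : entire f ->
  exists F : R[i] -> R[i], forall z : R[i], is_derive z 1 F (f z).
Proof.
move=> ef.
have cf := entire_continuous ef.
have hH (y : R) : exists G : R -> R[i], forall x, is_derive_curve G x (f (x +i* y)).
  apply: curve_primitive => x.
  apply: (@continuous_comp _ _ _ (fun x : R => x +i* y)); last exact: cf.
  have -> : (fun s : R => s +i* y) = (fun s : R => (0 +i* y) + s%:C * 1).
    by apply/funext => s; apply/eqP; rewrite eq_complex /=; apply/andP; split; apply/eqP; ring.
  exact: continuous_line.
have hV (x : R) : exists G : R -> R[i], forall y, is_derive_curve G y (f (x +i* y) * 'i).
  apply: curve_primitive => y.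
  apply: (@continuousM R[i]); last exact: cst_continuous.
  apply: (@continuous_comp _ _ _ (fun y : R => x +i* y)); last exact: cf.
  have -> : (fun s : R => x +i* s) = (fun s : R => (x +i* 0) + s%:C * 'i).
    by apply/funext => s; apply/eqP; rewrite eq_complex /=; apply/andP; split; apply/eqP; ring.
  exact: continuous_line.
have [H dH] := boolp.choice hH; have [V dV] := boolp.choice hV.
eexists => z; exact: (contour_primitive ef dH dV).
Qed.

(** * A maximum principle without integrals *)

Section MaximumPrinciple.
Context {R : realType}.
Implicit Types (z w h : R[i]) (r e M : R).

Lemma second_derivative_test (g g' : R -> R) (d k : R) : 0 < d ->
  (forall t : R, `|t| < d -> is_derive t 1 g (g' t)) ->
  is_derive (0 : R) 1 g' k ->
  (forall t, `|t| < d -> g t <= g 0) -> k <= 0.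
Proof.
move=> d0 dg [dg' dk] gmax; rewrite leNgt; apply/negP => k0.
have in_d (t : R) : t \in `](- d), d[ -> `|t| < d by rewrite in_itv /= ltr_norml.
have g'0 : g' 0 = 0.
  have [_ <-] := dg 0 (eq_ind_r (fun x => x < d) d0 (normr0 _)).
  have [||||_ //] := @derive1_at_max R g (- d) d 0.
  - by rewrite (le_trans _ (ltW d0)) // oppr_le0 ltW.
  - by move=> t /in_d /dg [].
  - by rewrite in_itv /= oppr_lt0 d0.
  - by move=> t /in_d; exact: gmax.
move: dg'; rewrite /derivable -[lim _]/('D_1 g' 0) => /cvg_ex [l fl].
have lk : l = k by rewrite -dk /derive (cvg_lim _ fl).
have : nbhs k [set y | 0 < y].
  apply/nbhs_ballP; exists k => //= y; rewrite /ball /= => /(le_lt_trans (ler_norm _)).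
  by rewrite ltrBlDr ltrDl.
rewrite -{1}lk => /fl; rewrite /nbhs /= /dnbhs /= => /nbhs_ballP [r /= r0 Hr].
have g'pos t : 0 < t -> t < r -> 0 < g' t.
  move=> t0 tr; have := Hr t; rewrite /ball /= sub0r normrN gtr0_norm //.
  move=> /(_ tr (lt0r_neq0 t0)); rewrite /= g'0 subr0 addr0 [t *: 1]mulr1.
  by rewrite -[_ *: _]/(t^-1 * g' t) pmulr_rgt0 ?invr_gt0.
pose s := Num.min (r / 2) (d / 2).
have s0 : 0 < s by rewrite lt_min !divr_gt0.
have sr : s < r by rewrite gt_min ltr_pdivrMr // ltr_pMr // ltrDl ltr01.
have sd : s < d by rewrite gt_min orbC ltr_pdivrMr // ltr_pMr // ltrDl ltr01.
have [||c cs E] := @MVT R g g' 0 s s0.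
- move=> t; rewrite in_itv /= => /andP [t0 ts]; apply: dg.
  by rewrite gtr0_norm // (lt_trans ts).
- apply: derivable_within_continuous => t; rewrite in_itv /= => /andP [t0 ts].
  by have [] := dg t _; rewrite ?ger0_norm // (le_lt_trans ts).
have : g s <= g 0 by apply: gmax; rewrite gtr0_norm.
rewrite -subr_le0 E subr0 leNgt pmulr_lgt0 //; apply/negP/negPn.
move: cs; rewrite in_itv /= => /andP [c0 cs].
by apply: g'pos => //; exact: lt_trans sr.
Qed.

Lemma normc_sqr z : Nc z ^+ 2 = complex.Re z ^+ 2 + complex.Im z ^+ 2.
Proof. by case: z => x y; rewrite /Nc /= sqr_sqrtr // addr_ge0 ?sqr_ge0. Qed.

(** Perturbing by a small multiple of [|z|^2] makes the Laplacian of the real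
    part positive, so no interior maximum off the origin can occur.  The origin
    is allowed as an exceptional point because the function vanishes there. *)
Lemma punctured_disc_max (phi phi1 phi2 : R[i] -> R[i]) r M :
  0 < r -> continuous phi -> phi 0 = 0 ->
  (forall z, z != 0 -> is_derive z 1 phi (phi1 z) /\ is_derive z 1 phi1 (phi2 z)) ->
  (forall z, Nc z = r -> Nc (phi z) <= M) ->
  forall z, Nc z <= r -> Nc (phi z) <= M.
Proof.
move=> r0 cphi phi0 dphi bM z0 z0r; rewrite leNgt; apply/negP => Mlt.
have M0 : 0 <= M.
  by apply: le_trans (normc_ge0 _) (bM r%:C _); rewrite normc_real gtr0_norm.
have [c Nc1 cE] := normc_rotate (phi z0).
(* On the disc the perturbation is at most half of the excess over M. *)
pose e := (Nc (phi z0) - M) / (2 * r ^+ 2).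
have e0 : 0 < e by rewrite divr_gt0 ?subr_gt0 // mulr_gt0 // exprn_gt0.
pose u z := complex.Re (c * phi z) + e * Nc z ^+ 2.
have cu : continuous u.
  have cRe : continuous (fun z : R[i] => complex.Re (c * phi z)).
    move=> z; apply: (@continuous_comp R[i] R[i] R (fun z => c * phi z) (@complex.Re R)).
      by apply: (@continuousM R[i]); [exact: cst_continuous|exact: cphi].
    exact: continuous_Re.
  have cN : continuous (fun z : R[i] => e * (Nc z * Nc z)).
    move=> z; have cz := @continuous_normc R z.
    exact: (@continuousM R R[i] (fun=> e) (fun z => Nc z * Nc z) z (@cst_continuous _ _ e z)
      (@continuousM R R[i] _ _ z cz cz)).
  by move=> z; rewrite /u; under eq_fun do rewrite expr2; exact: (continuousD (cRe z) (cN z)).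
have [z1 z1r maxz1] := disc_max 0 (ltW r0) cu.
rewrite subr0 in z1r.
have uz0 : Nc (phi z0) <= u z1.
  apply: le_trans (maxz1 z0 _); last by rewrite subr0.
  by rewrite /u cE lerDl mulr_ge0 ?sqr_ge0 // ltW.
have uM : u z1 < Nc (phi z0) -> False by rewrite ltNge uz0.
have [z1E|z1n0] := eqVneq z1 0.
  apply: uM; rewrite /u z1E phi0 mulr0 Normc.normc0 expr0n mulr0 addr0 /=.
  exact: le_lt_trans Mlt.
have [z1rE|z1nr] := eqVneq (Nc z1) r.
  apply: uM; rewrite /u z1rE.
  have : complex.Re (c * phi z1) <= M.
    apply: le_trans (ler_norm _) (le_trans (Re_le_normc _) _).
    by rewrite Normc.normcM Nc1 mul1r bM.
  have -> : e * r ^+ 2 = (Nc (phi z0) - M) / 2 by rewrite /e; field; rewrite gt_eqF.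
  by move: Mlt; lra.
have z1lt : Nc z1 < r by rewrite lt_neqAle z1nr.
have d0 : 0 < Num.min (Nc z1) (r - Nc z1) by rewrite lt_min normc_gt0 z1n0 subr_gt0.
set d := Num.min _ _ in d0.
(* The second derivative of u along b at the interior maximum z1; for b = 1 and
   b = 'i the terms with phi2 are opposite, because of the factor b ^+ 2. *)
have test b : Nc b = 1 -> complex.Re (c * (phi2 z1 * b ^+ 2)) + 2 * e <= 0.
  move=> Nb; pose p := complex.Re z1 * complex.Re b + complex.Im z1 * complex.Im b.
  have NE (t : R) : Nc (z1 + t%:C * b) ^+ 2 = Nc z1 ^+ 2 + 2 * p * t + t ^+ 2.
    have : Nc b ^+ 2 = 1 by rewrite Nb expr1n.
    rewrite !normc_sqr /p; case: (z1) (b) => [x y] [v w] /= vw.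
    transitivity (x ^+ 2 + y ^+ 2 + 2 * (x * v + y * w) * t + t ^+ 2 * (v ^+ 2 + w ^+ 2)); first by ring.
    by rewrite vw mulr1.
  have tb (t : R) : Nc (t%:C * b) = `|t| by rewrite Normc.normcM Nb mulr1 normc_real.
  have near0 (t : R) : `|t| < d -> z1 + t%:C * b != 0 /\ Nc (z1 + t%:C * b) <= r.
    rewrite lt_min => /andP [t1 t2]; split.
      rewrite -normc_gt0; have := ler_normcB z1 (- (t%:C * b)).
      by rewrite normcN opprK tb; apply: lt_le_trans; rewrite subr_gt0.
    apply: le_trans (le_normcD _ _) _; rewrite tb.
    by rewrite -lerBrDl ltW.
  pose g' t := complex.Re (c * (phi1 (z1 + t%:C * b) * b)) + e * (2 * p + 2 * t).
  apply: (@second_derivative_test (fun t => complex.Re (c * phi (z1 + t%:C * b)) +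
     e * (Nc z1 ^+ 2 + 2 * p * t + t ^+ 2)) g' d) => //.
  - move=> t /near0 [tn0 _]; apply: is_deriveD.
      by apply: is_derive_line; have [] := dphi _ tn0.
    have id1 : is_derive t 1 (@id R) 1 by exact: is_derive_id.
    have E := is_deriveZ e (is_deriveD (is_deriveD (is_derive_cst (Nc z1 ^+ 2 : R) t 1)
      (is_deriveZ (2 * p) id1)) (is_deriveM id1 id1)).
    apply: is_derive_eq E _.
    by rewrite add0r /= /GRing.scale /= !mulr1; ring.
  - have [_ d2] := dphi z1 z1n0.
    have E : g' = (fun t : R => complex.Re ((c * b) * phi1 (z1 + t%:C * b))) +
        e \*: (cst (2 * p) + 2 \*: @id R).
      by apply/funext => t; rewrite /g' /=; congr (complex.Re _ + _); rewrite mulrA mulrAC.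
    rewrite E; have -> : complex.Re (c * (phi2 z1 * b ^+ 2)) + 2 * e =
        complex.Re ((c * b) * (phi2 z1 * b)) + 2 * e.
      by congr (complex.Re _ + _); ring.
    apply: is_deriveD.
      by apply: is_derive_line; rewrite mul0r addr0.
    have id1 : is_derive (0 : R) 1 (@id R) 1 by exact: is_derive_id.
    have E2 := is_deriveZ e (is_deriveD (is_derive_cst (2 * p) (0 : R) 1) (is_deriveZ 2 id1)).
    by apply: is_derive_eq E2 _; rewrite add0r /GRing.scale /= mulr1 mulrC.
  - move=> t td; have := maxz1 (z1 + t%:C * b); rewrite subr0 => /(_ (near0 t td).2).
    rewrite /u NE => /le_trans; apply.
    by rewrite mul0r addr0 mulr0 addr0 expr0n addr0.
have := test 1; rewrite Normc.normc1 => /(_ erefl).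
have := test 'i normc_i.
rewrite expr1n sqr_i; move: (phi2 z1) (c) => [x y] [v w] /=; move: e0; lra.
Qed.

End MaximumPrinciple.

(** * Cauchy estimates for twice differentiable functions *)

Section CauchyEstimates.
Context {R : realType}.
Implicit Types (z w h : R[i]) (r e M : R).

Lemma is_derive_shiftC (f : R[i] -> R[i]) a z d :
  is_derive (a + z) 1 f d -> is_derive z 1 (fun w => f (a + w)) d.
Proof.
move=> /is_derive_normcP df; apply/is_derive_normcP => e /df [r r0 Hr].
by exists r => // h /Hr; rewrite addrA.
Qed.

Lemma is_derive_mulC (f g : R[i] -> R[i]) z df dg :
  is_derive z 1 f df -> is_derive z 1 g dg ->
  is_derive z 1 (fun w => f w * g w) (df * g z + f z * dg).
Proof.
move=> hf hg; apply: is_derive_eq (is_deriveM hf hg) _.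
by rewrite -[f z *: dg]/(f z * dg) -[g z *: df]/(g z * df) addrC [g z * df]mulrC.
Qed.

Lemma is_derive_addC (f g : R[i] -> R[i]) z df dg :
  is_derive z 1 f df -> is_derive z 1 g dg ->
  is_derive z 1 (fun w => f w + g w) (df + dg).
Proof. by move=> hf hg; exact: is_deriveD. Qed.

Lemma is_derive_mulCl (f : R[i] -> R[i]) c z df :
  is_derive z 1 f df -> is_derive z 1 (fun w => c * f w) (c * df).
Proof. by move=> hf; exact: (is_deriveZ c hf). Qed.

(** The origin is left out for the sake of difference quotients based there. *)
Definition twice_derivable (f : R[i] -> R[i]) :=
  exists f1 f2 : R[i] -> R[i],
    forall z, z != 0 -> is_derive z 1 f (f1 z) /\ is_derive z 1 f1 (f2 z).

Lemma twice_derivable_entire (f f1 f2 : R[i] -> R[i]) :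
  (forall z, is_derive z 1 f (f1 z)) -> (forall z, is_derive z 1 f1 (f2 z)) ->
  twice_derivable f.
Proof. by move=> d1 d2; exists f1, f2 => z _; split. Qed.

Lemma twice_derivableM f g :
  twice_derivable f -> twice_derivable g -> twice_derivable (fun z => f z * g z).
Proof.
move=> [f1 [f2 df]] [g1 [g2 dg]].
exists (fun z => f1 z * g z + f z * g1 z).
exists (fun z => (f2 z * g z + f1 z * g1 z) + (f1 z * g1 z + f z * g2 z)) => z z0.
have [df1 df2] := df z z0; have [dg1 dg2] := dg z z0.
by split; [|apply: is_derive_addC]; exact: is_derive_mulC.
Qed.

Lemma twice_derivable_id : twice_derivable id.
Proof.
exact: (@twice_derivable_entire _ (cst 1) (cst 0)).
Qed.

Lemma twice_derivable_inv : twice_derivable (fun z => z^-1).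
Proof.
exists (fun z => - (z^-1 * z^-1)).
exists (fun z => 2 * z^-1 ^+ 3) => z z0.
have dV : is_derive z 1 (fun w : R[i] => w^-1) (- (z^-1 * z^-1)).
  have did : derivable (@id R[i]) z 1 by exact: derivable_id.
  apply: DeriveDef; first exact: (@derivableV _ _ (@id R[i]) z 1 z0 did).
  rewrite (@deriveV _ _ (@id R[i]) z 1 z0 did) derive_id.
  by rewrite [LHS]mulr1 expr2 invfM.
split=> //; have E : (fun w : R[i] => - (w^-1 * w^-1)) = (fun w => -1 * (w^-1 * w^-1)).
  by apply/funext => w; rewrite mulN1r.
rewrite E; apply: is_derive_eq (is_derive_mulCl (-1) (is_derive_mulC dV dV)) _.
by ring.
Qed.

Lemma twice_derivableX f n :
  twice_derivable f -> twice_derivable (fun z => f z ^+ n).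
Proof.
move=> df; elim: n => [|n ih].
  have -> : (fun z => f z ^+ 0) = cst 1 by apply/funext => z; rewrite expr0.
  exact: (@twice_derivable_entire _ (cst 0) (cst 0)).
have -> : (fun z => f z ^+ n.+1) = (fun z => f z * f z ^+ n).
  by apply/funext => z; rewrite exprS.
exact: twice_derivableM.
Qed.

Lemma bernoulli_le (x : R) n : 0 <= x -> 1 + x *+ n <= (1 + x) ^+ n.
Proof.
move=> x0; elim: n => [|n ih]; first by rewrite mulr0n addr0 expr0.
rewrite exprS; apply: le_trans (ler_wpM2l (addr_ge0 ler01 x0) ih).
rewrite mulrDl mul1r mulrDr mulr1 mulrSr addrA lerD2l.
by rewrite lerDl mulr_ge0 // mulrn_wge0.
Qed.

(** The bound on the circle passes to the punctured disc even though q may not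
    extend to the origin: [z * q z ^+ n] vanishes there, and the spurious factor
    disappears in the limit of large [n]. *)
Lemma punctured_disc_bounded_max (q : R[i] -> R[i]) r M d B :
  0 < r -> 0 < d -> twice_derivable q ->
  (forall z, z != 0 -> Nc z < d -> Nc (q z) <= B) ->
  (forall z, Nc z = r -> Nc (q z) <= M) ->
  forall z, z != 0 -> Nc z <= r -> Nc (q z) <= M.
Proof.
move=> r0 d0 dq qB qM z0 z0n0 z0r; rewrite leNgt; apply/negP => Mlt.
have M0 : 0 <= M.
  by apply: le_trans (normc_ge0 _) (qM r%:C _); rewrite normc_real gtr0_norm.
have key n : Nc z0 * Nc (q z0) ^+ n <= r * M ^+ n.
  have := twice_derivableM twice_derivable_id (twice_derivableX n dq).
  move=> [f1 [f2 df]]; rewrite -normcX -Normc.normcM.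
  apply: (punctured_disc_max (phi := fun z => z * q z ^+ n) r0 _ _ df) => //.
  - move=> z; have [->|zn0] := eqVneq z 0; last first.
      by have [] := df z zn0 => + _; exact: is_derive_continuous.
    apply/continuous_normcP => e e0.
    have BB0 : 0 < `|B| ^+ n + 1 by rewrite ltr_wpDl // exprn_ge0.
    exists (Num.min d (e / (`|B| ^+ n + 1))).
      by rewrite lt_min d0 divr_gt0.
    move=> w; rewrite subr0 mul0r subr0 lt_min => /andP [wd we].
    rewrite Normc.normcM normcX; have [->|wn0] := eqVneq w 0.
      by rewrite Normc.normc0 mul0r.
    move: we; rewrite ltr_pdivlMr //; apply: le_lt_trans.
    rewrite ler_wpM2l ?normc_ge0 // (le_trans (lerXn2r n _ _ (qB w wn0 wd))) ?nnegrE ?normc_ge0 //.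
      exact: le_trans (normc_ge0 _) (qB w wn0 wd).
    rewrite (@le_trans _ _ (`|B| ^+ n)) ?lerDl // -normrX; exact: ler_norm.
  - by rewrite mul0r.
  - move=> z zr; rewrite Normc.normcM normcX zr ler_wpM2l ?(ltW r0) //.
    by rewrite lerXn2r ?nnegrE ?normc_ge0 // qM.
have Nz0 : 0 < Nc z0 by rewrite normc_gt0.
have Nq0 : 0 < Nc (q z0) by exact: le_lt_trans Mlt.
have [ME|Mn0] := eqVneq M 0.
  have := key 1%N; rewrite ME !expr1 mulr0 leNgt.
  by rewrite mulr_gt0.
have Mp : 0 < M by rewrite lt_def Mn0.
pose x := Nc (q z0) / M - 1.
have x0 : 0 < x by rewrite subr_gt0 ltr_pdivlMr // mul1r.
pose n := Num.bound (r / Nc z0 / x).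
have nb : r / Nc z0 / x < n%:R by apply: archi_boundP; rewrite divr_ge0 ?divr_ge0 ?ltW.
have := key n; apply/negP; rewrite -ltNge.
suff : r / Nc z0 < (Nc (q z0) / M) ^+ n.
  rewrite expr_div_n ltr_pdivlMr ?exprn_gt0 // mulrAC ltr_pdivrMr //.
  by rewrite [ltRHS]mulrC.
have -> : Nc (q z0) / M = 1 + x by rewrite /x addrC subrK.
apply: lt_le_trans (bernoulli_le n (ltW x0)).
by rewrite ltr_pwDl // ltW // -mulr_natl -ltr_pdivrMr.
Qed.

Variables (T T1 T2 : R[i] -> R[i]).
Hypothesis dT : forall z, is_derive z 1 T (T1 z).
Hypothesis dT1 : forall z, is_derive z 1 T1 (T2 z).

(** The difference quotient of T at 0 is twice differentiable away from 0 and
    tends to T1 0 at 0, so its bound on the circle bounds T1 0. *)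
Lemma cauchy_estimate1_0 r M : 0 < r ->
  (forall z, Nc z <= r -> Nc (T z) <= M) -> Nc (T1 0) <= 2 * M / r.
Proof.
move=> r0 TM; pose q z := (T z - T 0) * z^-1.
have near0 e : 0 < e -> exists2 d, 0 < d &
    forall z, z != 0 -> Nc z < d -> Nc (q z - T1 0) <= e.
  move=> e0; have /is_derive_normcP/(_ _ e0) [d d0 Hd] := dT 0; exists d => // z zn0 zd.
  have := Hd z zd; rewrite add0r => Hz.
  rewrite -(ler_pM2r (x := Nc z)) ?normc_gt0 // -[leLHS]Normc.normcM.
  by rewrite /q mulrBl mulfVK.
have dq : twice_derivable q.
  apply: twice_derivableM twice_derivable_inv.
  apply: (@twice_derivable_entire _ T1 T2) => // z.
  by have := is_derive_addC (dT z) (is_derive_cst (- T 0) z 1); rewrite addr0.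
have [d1 d10 Hd1] := near0 1 ltr01.
have bq : forall z, z != 0 -> Nc z < d1 -> Nc (q z) <= 1 + Nc (T1 0).
  move=> z zn0 zd; have := le_normcD (q z - T1 0) (T1 0).
  by rewrite subrK => /le_trans; apply; rewrite lerD2r Hd1.
have := punctured_disc_bounded_max (M := 2 * M / r) r0 d10 dq bq.
move=> H; apply/ler_addgt0Pl => e e0.
have [d2 d20 Hd2] := near0 e e0.
pose s := Num.min (d2 / 2) r; have s0 : 0 < s by rewrite lt_min r0 divr_gt0.
have sC0 : s%:C != 0 by rewrite fmorph_eq0 gt_eqF.
have Ns : Nc s%:C = s by rewrite normc_real gtr0_norm.
have : Nc (T1 0) <= Nc (q s%:C - T1 0) + Nc (q s%:C).
  rewrite normc_distC; have := le_normcD (T1 0 - q s%:C) (q s%:C).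
  by rewrite subrK.
move=> /le_trans; apply; apply: lerD.
  by apply: Hd2; rewrite ?Ns // gt_min ltr_pdivrMr // ltr_pMr // ltrDl ltr01.
apply: H => //; last by rewrite Ns ge_min lexx orbT.
move=> z zr; rewrite Normc.normcM Normc.normcV zr ler_wpM2r ?invr_ge0 ?(ltW r0) //.
apply: le_trans (le_normcD _ _) _; rewrite normcN mulrDl mul1r lerD // TM ?zr //.
by rewrite Normc.normc0 ltW.
Qed.

(** The same argument with the second-order quotient
    [(T z - T 0 - T1 0 z) / z^2], which tends to [T2 0 / 2].  It bounds the
    derivative of a function T1 of which only a primitive is controlled. *)
Lemma cauchy_estimate2_0 r M : 0 < r ->
  (forall z, Nc z <= r -> Nc (T z) <= M) -> Nc (T2 0) <= 8 * M / r ^+ 2.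
Proof.
move=> r0 TM; pose p z := T z + (- T 0 + - T1 0 * z); pose q z := p z * (z^-1 * z^-1).
have near0 e : 0 < e -> exists2 d, 0 < d &
    forall z, z != 0 -> Nc z < d -> Nc (q z - T2 0 / 2) <= e.
  move=> e0; have /is_derive_normcP/(_ _ e0) [d d0 Hd] := dT1 0; exists d => // z zn0 zd.
  have Nz : 0 < Nc z by rewrite normc_gt0.
  pose S w := T w + (- T1 0 * w + - (T2 0 / 2) * (w * w)).
  have dS w : is_derive w 1 S (T1 w - T1 0 - T2 0 * w).
    have id1 : is_derive w 1 (@id R[i]) 1 by exact: is_derive_id.
    apply: is_derive_eq (is_derive_addC (dT w) (is_derive_addC
      (is_derive_mulCl (- T1 0) id1)
      (is_derive_mulCl (- (T2 0 / 2)) (is_derive_mulC id1 id1)))) _.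
    by field.
  have := @normc_MVT _ S (fun w => T1 w - T1 0 - T2 0 * w) 0 z (e * Nc z).
  rewrite add0r => MV.
  have {}MV : Nc (S z - S 0) <= e * Nc z * Nc z.
    apply: MV => t /andP [t0 t1]; rewrite add0r; split; first exact: dS.
    have tz : Nc (t%:C * z) <= Nc z.
      by rewrite Normc.normcM normc_real ger0_norm // ler_piMl // normc_ge0.
    have := Hd (t%:C * z) (le_lt_trans tz zd); rewrite add0r => /le_trans; apply.
    by rewrite ler_pM2l.
  rewrite -(ler_pM2r Nz) -(ler_pM2r Nz) -Normc.normcM -Normc.normcM.
  suff -> : (q z - T2 0 / 2) * z * z = S z - S 0 by [].
  by rewrite /q /p /S; field.
have id1 z : is_derive z 1 (@id R[i]) 1 by exact: is_derive_id.
have dp1 z : is_derive z 1 p (T1 z + - T1 0).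
  have := is_derive_addC (dT z) (is_derive_addC (is_derive_cst (- T 0) z 1)
    (is_derive_mulCl (- T1 0) (id1 z))).
  by rewrite add0r mulr1.
have dp2 z : is_derive z 1 (fun z => T1 z + - T1 0) (T2 z).
  by have := is_derive_addC (dT1 z) (is_derive_cst (- T1 0) z 1); rewrite addr0.
have dp := twice_derivable_entire dp1 dp2.
have dq : twice_derivable q.
  apply: twice_derivableM dp _.
  exact: twice_derivableM twice_derivable_inv twice_derivable_inv.
have [d1 d10 Hd1] := near0 1 ltr01.
have bq : forall z, z != 0 -> Nc z < d1 -> Nc (q z) <= 1 + Nc (T2 0 / 2).
  move=> z zn0 zd; have := le_normcD (q z - T2 0 / 2) (T2 0 / 2).
  by rewrite subrK => /le_trans; apply; rewrite lerD2r Hd1.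
have H := punctured_disc_bounded_max (M := 4 * M / r ^+ 2) r0 d10 dq bq.
have T20 : Nc (T2 0) = 2 * Nc (T2 0 / 2).
  have N2 : Nc (2 : R[i]) = 2.
    have -> : (2 : R[i]) = 2%:C by rewrite rmorph_nat.
    by rewrite normc_real ger0_norm.
  by rewrite Normc.normcM Normc.normcV N2; field.
rewrite T20 (_ : 8 * M / r ^+ 2 = 2 * (4 * M / r ^+ 2)); last by ring.
rewrite ler_pM2l //; apply/ler_addgt0Pl => e e0.
have [d2 d20 Hd2] := near0 e e0.
pose s := Num.min (d2 / 2) r; have s0 : 0 < s by rewrite lt_min r0 divr_gt0.
have sC0 : s%:C != 0 by rewrite fmorph_eq0 gt_eqF.
have Ns : Nc s%:C = s by rewrite normc_real gtr0_norm.
have : Nc (T2 0 / 2) <= Nc (q s%:C - T2 0 / 2) + Nc (q s%:C).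
  rewrite normc_distC; have := le_normcD (T2 0 / 2 - q s%:C) (q s%:C).
  by rewrite subrK.
move=> /le_trans; apply; apply: lerD.
  by apply: Hd2; rewrite ?Ns // gt_min ltr_pdivrMr // ltr_pMr // ltrDl ltr01.
apply: H => //; last by rewrite Ns ge_min lexx orbT.
move=> z zr; rewrite !Normc.normcM !Normc.normcV zr -invfM -expr2.
rewrite ler_wpM2r ?invr_ge0 ?exprn_ge0 ?(ltW r0) //.
rewrite (_ : 4 * M = M + (M + 2 * M)); last by ring.
apply: le_trans (le_normcD _ _) _; rewrite lerD ?TM ?zr //.
apply: le_trans (le_normcD _ _) _; rewrite normcN lerD ?TM ?Normc.normc0 ?(ltW r0) //.
rewrite Normc.normcM normcN zr -ler_pdivlMr //; exact: cauchy_estimate1_0.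
Qed.

End CauchyEstimates.

(** * Derivatives of entire functions are entire *)

Section EntireDerivative.
Context {R : realType}.
Implicit Types (z w h : R[i]) (r e M : R).

Lemma cauchy_estimate1 (T T1 T2 : R[i] -> R[i]) z r M :
  (forall w, is_derive w 1 T (T1 w)) -> (forall w, is_derive w 1 T1 (T2 w)) ->
  0 < r -> (forall w, Nc (w - z) <= r -> Nc (T w) <= M) ->
  Nc (T1 z) <= 2 * M / r.
Proof.
move=> dT dT1 r0 TM; rewrite -[z in T1 z]addr0.
apply: (cauchy_estimate1_0 (T := fun w => T (z + w)) (T1 := fun w => T1 (z + w))
  (T2 := fun w => T2 (z + w))) => // [w|w|w wr]; try exact: is_derive_shiftC.
by apply: TM; rewrite [z + w]addrC addrK.
Qed.

Lemma cauchy_estimate2 (T T1 T2 : R[i] -> R[i]) z r M :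
  (forall w, is_derive w 1 T (T1 w)) -> (forall w, is_derive w 1 T1 (T2 w)) ->
  0 < r -> (forall w, Nc (w - z) <= r -> Nc (T w) <= M) ->
  Nc (T2 z) <= 8 * M / r ^+ 2.
Proof.
move=> dT dT1 r0 TM; rewrite -[z in T2 z]addr0.
apply: (cauchy_estimate2_0 (T := fun w => T (z + w)) (T1 := fun w => T1 (z + w))
  (T2 := fun w => T2 (z + w))) => // [w|w|w wr]; try exact: is_derive_shiftC.
by apply: TM; rewrite [z + w]addrC addrK.
Qed.

(** The difference quotients of f' are second derivatives of those of a
    primitive F, which converge uniformly near z, so the second-order Cauchy
    estimate makes the former a Cauchy family as the increment tends to 0. *)
Lemma entire_derive1 (f : R[i] -> R[i]) : entire f -> entire (f^`()%classic).
Proof.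
move=> ef; have [F dF] := entire_primitive ef; have df := entire_is_derive ef.
set f' := f^`()%classic in df *.
have cF : continuous F by move=> w; exact: is_derive_continuous (dF w).
move=> z; have [M M0 FM] := disc_bounded z 3 cF.
pose B := 8 * M.
have B0 : 0 < B by rewrite mulr_gt0.
have f'B w : Nc (w - z) <= 2 -> Nc (f' w) <= B.
  move=> wz; have -> : B = 8 * M / 1 ^+ 2 by rewrite expr1n divr1.
  apply: (cauchy_estimate2 dF df ltr01) => v vw; apply: FM.
  rewrite (_ : v - z = (v - w) + (w - z)); last by ring.
  apply: le_trans (le_normcD _ _) _; rewrite (_ : 3 = 1 + 2) ?lerD //; ring.
have seg (t : R) w h : 0 <= t <= 1 -> Nc (w - z) <= 1 -> Nc h <= 1 ->
    Nc (t%:C * h) <= Nc h /\ Nc (w + t%:C * h - z) <= 2.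
  move=> /andP [t0 t1] wz h1.
  have th : Nc (t%:C * h) <= Nc h.
    by rewrite Normc.normcM normc_real ger0_norm // ler_piMl // normc_ge0.
  split=> //; rewrite addrAC; apply: le_trans (le_normcD _ _) _.
  by rewrite (_ : 2 = 1 + 1) ?lerD ?(le_trans th).
have fLip w h : Nc (w - z) <= 1 -> Nc h <= 1 -> Nc (f (w + h) - f w) <= B * Nc h.
  move=> wz h1; apply: normc_MVT => t t01; have [_ wt] := seg t w h t01 wz h1.
  by split; [exact: df|exact: f'B].
have FLip w h : Nc (w - z) <= 1 -> Nc h <= 1 ->
    Nc (F (w + h) - F w - f w * h) <= B * Nc h * Nc h.
  move=> wz h1; pose S v := F v + - f w * v.
  have -> : F (w + h) - F w - f w * h = S (w + h) - S w by rewrite /S; ring.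
  apply: (@normc_MVT _ S (fun v => f v + - f w)) => t t01.
  have [th wt] := seg t w h t01 wz h1; split.
    have := is_derive_addC (dF (w + t%:C * h))
      (is_derive_mulCl (- f w) (is_derive_id (w + t%:C * h) 1)).
    by rewrite mulr1.
  apply: le_trans (fLip _ _ wz (le_trans th h1)) _.
  by rewrite ler_pM2l.
pose q h := (f' (z + h) - f' z) / h.
have qC (h k : R[i]) : h != 0 -> k != 0 -> Nc h <= 1 -> Nc k <= 1 ->
    Nc (q h - q k) <= 8 * B * (Nc h + Nc k).
  move=> h0 k0 h1 k1.
  pose quo (g : R[i] -> R[i]) (s w : R[i]) := s^-1 * (g (s + w) + -1 * g w).
  have dquo (g g' : R[i] -> R[i]) (s w : R[i]) : (forall v : R[i], is_derive v 1 g (g' v)) ->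
      is_derive w 1 (quo g s) (quo g' s w).
    move=> dg; exact: (is_derive_mulCl s^-1 (is_derive_addC
      (is_derive_shiftC (dg (s + w))) (is_derive_mulCl (-1) (dg w)))).
  pose D (g : R[i] -> R[i]) w := quo g h w + -1 * quo g k w.
  have dD (g g' : R[i] -> R[i]) (w : R[i]) : (forall v : R[i], is_derive v 1 g (g' v)) ->
      is_derive w 1 (D g) (D g' w).
    move=> dg; exact: (is_derive_addC (dquo _ _ h w dg)
      (is_derive_mulCl (-1) (dquo _ _ k w dg))).
  have -> : q h - q k = D f' z by rewrite /D /quo /q mulN1r !mulN1r [h + z]addrC [k + z]addrC ![_^-1 * _]mulrC.
  have -> : 8 * B * (Nc h + Nc k) = 8 * (B * (Nc h + Nc k)) / 1 ^+ 2.
    by rewrite expr1n divr1 mulrA.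
  have dDF w := dD F f w dF; have dDf w := dD f f' w df.
  apply: (cauchy_estimate2 dDF dDf ltr01) => w wz.
  have quoF s : s != 0 -> Nc s <= 1 -> Nc (quo F s w - f w) <= B * Nc s.
    move=> s0 s1; have Ns : 0 < Nc s by rewrite normc_gt0.
    rewrite -(ler_pM2r Ns) -Normc.normcM.
    have -> : (quo F s w - f w) * s = F (w + s) - F w - f w * s.
      by rewrite /quo [s + w]addrC; field.
    exact: FLip.
  have -> : D F w = (quo F h w - f w) + - (quo F k w - f w) by rewrite /D; ring.
  by apply: le_trans (le_normcD _ _) _; rewrite normcN mulrDr lerD ?quoF.
have [L HL] : exists L, forall h, h != 0 -> Nc h <= 1 -> Nc (q h - L) <= 16 * B * Nc h.
  (* The limit is the supremum of the lower bounds [g h - 8 B |h|]. *)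
  have lim_of (g : R[i] -> R) : (forall h k, h != 0 -> k != 0 -> Nc h <= 1 -> Nc k <= 1 ->
      `|g h - g k| <= 8 * B * (Nc h + Nc k)) ->
      exists l, forall h, h != 0 -> Nc h <= 1 -> `|g h - l| <= 8 * B * Nc h.
    move=> gC; pose S := [set x | exists2 h, h != 0 /\ Nc h <= 1 & x = g h - 8 * B * Nc h].
    have ub k : k != 0 -> Nc k <= 1 -> ubound S (g k + 8 * B * Nc k).
      move=> k0 k1 _ [h [h0 h1] ->]; have := gC h k h0 k0 h1 k1.
      by rewrite ler_norml => /andP [_]; rewrite mulrDr; lra.
    have N1 : Nc (1 : R[i]) <= 1 by rewrite Normc.normc1.
    have S0 : S !=set0 by exists (g 1 - 8 * B * Nc 1); exists 1; rewrite ?oner_neq0.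
    exists (sup S) => h h0 h1; rewrite ler_norml; apply/andP; split.
      by have := sup_le_ub S0 (ub h h0 h1); lra.
    have : g h - 8 * B * Nc h <= sup S.
      by apply: ub_le_sup; [exists (g 1 + 8 * B * Nc 1); apply: ub; rewrite ?oner_neq0|exists h].
    lra.
  have [l1 Hl1] : exists l, forall h, h != 0 -> Nc h <= 1 ->
      `|complex.Re (q h) - l| <= 8 * B * Nc h.
    apply: lim_of => h k h0 k0 h1 k1; rewrite -raddfB.
    exact: le_trans (Re_le_normc _) (qC h k h0 k0 h1 k1).
  have [l2 Hl2] : exists l, forall h, h != 0 -> Nc h <= 1 ->
      `|complex.Im (q h) - l| <= 8 * B * Nc h.
    apply: lim_of => h k h0 k0 h1 k1; rewrite -raddfB.
    exact: le_trans (Im_le_normc _) (qC h k h0 k0 h1 k1).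
  exists (l1 +i* l2) => h h0 h1; apply: le_trans (normc_le_ReIm _) _.
  have -> : 16 * B * Nc h = 8 * B * Nc h + 8 * B * Nc h by ring.
  have := lerD (Hl1 h h0 h1) (Hl2 h h0 h1).
  by case: (q h).
suff [] : is_derive z 1 f' L by [].
apply/is_derive_normcP => e e0.
exists (Num.min 1 (e / (16 * B))); first by rewrite lt_min ltr01 divr_gt0 ?mulr_gt0.
move=> h; rewrite lt_min => /andP [/ltW h1 he].
have [->|h0] := eqVneq h 0; first by rewrite addr0 subrr mulr0 subr0 Normc.normc0 mulr0.
have -> : f' (z + h) - f' z - L * h = (q h - L) * h.
  by rewrite mulrBl /q divfK.
rewrite Normc.normcM ler_wpM2r ?normc_ge0 //.
apply: le_trans (HL h h0 h1) _.
by rewrite mulrC -ler_pdivlMr ?mulr_gt0 // ltW.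
Qed.

Lemma cauchy_estimate (f : R[i] -> R[i]) z r M : entire f -> 0 < r ->
  (forall w, Nc (w - z) <= r -> Nc (f w) <= M) ->
  Nc (f^`()%classic z) <= 2 * M / r.
Proof.
move=> ef; apply: cauchy_estimate1; first exact: entire_is_derive.
by move=> w; apply: entire_is_derive; exact: entire_derive1.
Qed.

Lemma entire_derive1n (f : R[i] -> R[i]) m : entire f -> entire (f^`(m)%classic).
Proof.
move=> ef; elim: m => [|m ih]; first exact: ef.
rewrite derive1nS; exact: (entire_derive1 ih).
Qed.

End EntireDerivative.

(** * Continuous functions are measurable on the plane *)

Section PlaneMeasurability.
Context {R : realType}.
Implicit Types (z w : R[i]) (u : R[i] -> R) (r a : R).
Local Notation plane := (measurableTypeR R * measurableTypeR R)%type.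

Definition plane_measurable u :=
  measurable_fun [set: plane] (fun w : plane => u (of_plane w) : measurableTypeR R).

(** An open set of the plane is a countable union of rational boxes, so the
    product sigma-algebra contains it. *)
Lemma continuous_plane_measurable u : continuous u -> plane_measurable u.
Proof.
move=> cu; apply: (measurability (@RGenOInfty.G R)); first exact: RGenOInfty.measurableE.
move=> _ [_ [a ->] <-]; rewrite setTI.
pose O : set (R * R) := [set w : R * R | a < u (w.1 +i* w.2)].
pose box (q1 q2 : rat) (n : nat) : set (R * R) :=
  `]ratr q1 - n.+1%:R^-1, ratr q1 + n.+1%:R^-1[ `*`
  `]ratr q2 - n.+1%:R^-1, ratr q2 + n.+1%:R^-1[.
have -> : (fun w : plane => u (of_plane w)) @^-1` `]a, +oo[ =
    \bigcup_q1 \bigcup_q2 \bigcup_n (if `[< box q1 q2 n `<=` O >] then box q1 q2 n else set0).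
  apply/seteqP; split; last first.
    move=> w [q1 _ [q2 _ [n _]]]; case: ifPn => // /asboolP sub /sub.
    by rewrite /O /= in_itv /= andbT.
  move=> [x y]; rewrite /= in_itv /= andbT => axy.
  pose e := u (x +i* y) - a; have e0 : 0 < e by rewrite subr_gt0.
  have [d d0 Hd] := (continuous_real_normcP u (x +i* y)).1 (cu _) e e0.
  pose n := Num.bound (4 / d).
  have n0 : (0 : R) < n.+1%:R by rewrite ltr0Sn.
  have nd : 4 * n.+1%:R^-1 < d.
    rewrite ltr_pdivrMr // -ltr_pdivrMl // mulrC.
    apply: lt_le_trans (archi_boundP _) _; first by rewrite divr_ge0 ?ltW.
    by rewrite ler_nat.
  have near_rat (t : R) : exists q : rat, `|t - ratr q| < n.+1%:R^-1.
    have : t - n.+1%:R^-1 < t by rewrite ltrBlDr ltrDl invr_gt0.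
    move=> /rat_in_itvoo [q]; rewrite in_itv /= => /andP [q1 q2].
    by exists q; rewrite gtr0_norm ?subr_gt0 // ltrBlDr -ltrBlDl.
  have [q1 xq1] := near_rat x; have [q2 yq2] := near_rat y.
  exists q1 => //; exists q2 => //; exists n => //.
  have inbox (s t : R) : box q1 q2 n (s, t) <->
      `|s - ratr q1| < n.+1%:R^-1 /\ `|t - ratr q2| < n.+1%:R^-1.
    have aux (v c b : R) : (c - b < v < c + b) = (`|v - c| < b).
      by rewrite ltr_norml; apply/idP/idP => /andP [? ?]; apply/andP; split; lra.
    by rewrite /box /= !in_itv /= !aux.
  case: ifPn => [_|/asboolPn]; first exact/inbox.
  case=> -[s t] /inbox [sq1 tq2]; rewrite /O /=.
  have := Hd (s +i* t) _; rewrite ltr_norml => /(_ _)/andP [|+ _]; last first.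
    by rewrite /e; lra.
  apply: le_lt_trans (normc_le_ReIm _) _; apply: le_lt_trans _ nd => /=.
  rewrite (_ : s - x = (s - ratr q1) - (x - ratr q1)); last by ring.
  rewrite (_ : t - y = (t - ratr q2) - (y - ratr q2)); last by ring.
  have := ler_normB (s - ratr q1) (x - ratr q1).
  have := ler_normB (t - ratr q2) (y - ratr q2).
  move: sq1 tq2 xq1 yq2; move: (n.+1%:R^-1) => b.
  move: `|s - ratr q1| `|t - ratr q2| `|x - ratr q1| `|y - ratr q2| => *.
  lra.
apply: bigcupT_measurable_rat => q1; apply: bigcupT_measurable_rat => q2.
apply: bigcupT_measurable => n; case: ifPn => _ //.
by apply: measurableX; exact: measurable_itv.
Qed.

End PlaneMeasurability.

(** * Integration over the plane and averages over small discs *)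

Section PlaneIntegral.
Context {R : realType}.
Implicit Types (z w : R[i]) (u v : R[i] -> R) (r a M : R).
Local Notation plane := (measurableTypeR R * measurableTypeR R)%type.

Definition plane_int u : \bar R := (\int[@area R]_w (u (of_plane w))%:E)%E.

Definition joint_measurable (K : R[i] -> R[i] -> R) :=
  measurable_fun [set: plane * plane]
    (fun v : plane * plane => K (of_plane v.1) (of_plane v.2) : measurableTypeR R).

Lemma plane_int_ge0 u : (forall z, 0 <= u z) -> (0 <= plane_int u)%E.
Proof. by move=> u0; apply: integral_ge0 => w _; rewrite lee_fin. Qed.

Lemma le_plane_int u v : plane_measurable u -> plane_measurable v ->
  (forall z, 0 <= u z <= v z) -> (plane_int u <= plane_int v)%E.
Proof.
move=> mu mv uv; apply: ge0_le_integral => //.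
- by move=> w _; rewrite lee_fin; case/andP: (uv (of_plane w)).
- exact/measurable_EFinP.
- exact/measurable_EFinP.
- by move=> w _; rewrite lee_fin; case/andP: (uv (of_plane w)).
Qed.

Lemma plane_intZ u M : plane_measurable u -> 0 <= M -> (forall z, 0 <= u z) ->
  plane_int (fun z => M * u z) = (M%:E * plane_int u)%E.
Proof.
move=> mu M0 u0; rewrite -ge0_integralZl_EFin //.
- by move=> w _; rewrite lee_fin.
- exact/measurable_EFinP.
Qed.

Lemma plane_intD u v : plane_measurable u -> plane_measurable v ->
  (forall z, 0 <= u z) -> (forall z, 0 <= v z) ->
  plane_int (fun z => u z + v z) = (plane_int u + plane_int v)%E.
Proof.
move=> mu mv u0 v0; rewrite -ge0_integralD //.
- by move=> w _; rewrite lee_fin.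
- exact/measurable_EFinP.
- by move=> w _; rewrite lee_fin.
- exact/measurable_EFinP.
Qed.

Lemma area_square (a b l : R) : 0 <= l ->
  @area R (`[a, a + l]%classic `*` `[b, b + l]%classic) = (l ^+ 2)%:E.
Proof.
move=> l0; transitivity (@lebesgue_measure R (`[a, (a + l)%R]%classic : set R) *
    @lebesgue_measure R (`[b, (b + l)%R]%classic : set R))%E.
  by apply: (@product_measure1E _ _ _ _ R (@lebesgue_measure R) (@lebesgue_measure R));
    exact: measurable_itv.
rewrite !lebesgue_measure_itv /= !lte_fin !ltrDl; have [l1|l1] := ltP 0 l.
  by rewrite -!EFinB -EFinM expr2 ![_ + l]addrC !addrK.
by have -> : l = 0; [apply/eqP; rewrite eq_le l0 l1|rewrite expr2 !mul0r mule0].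
Qed.

Lemma plane_measurable_cst M : plane_measurable (fun=> M).
Proof. exact: measurable_cst. Qed.

Lemma plane_measurableM u v : plane_measurable u -> plane_measurable v ->
  plane_measurable (fun z => u z * v z).
Proof. exact: measurable_funM. Qed.

Lemma plane_measurableD u v : plane_measurable u -> plane_measurable v ->
  plane_measurable (fun z => u z + v z).
Proof. exact: measurable_funD. Qed.

Lemma plane_measurable_if_le u v f g : plane_measurable u -> plane_measurable v ->
  plane_measurable f -> plane_measurable g ->
  plane_measurable (fun z => if u z <= v z then f z else g z).
Proof. by move=> *; apply: measurable_fun_ifT => //; exact: measurable_fun_ler. Qed.

Lemma plane_measurable_powR u r : plane_measurable u ->
  plane_measurable (fun z => u z `^ r).
Proof.
move=> mu; apply: (@measurableT_comp _ _ _ _ _ _ (fun x : measurableTypeR R => x `^ r)).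
  exact: measurable_powR.
exact: mu.
Qed.

Lemma plane_measurable_normc : plane_measurable (fun z => Nc z).
Proof. exact: continuous_plane_measurable continuous_normc. Qed.

Lemma plane_measurable_dist z : plane_measurable (fun w => Nc (w - z)).
Proof. exact: continuous_plane_measurable (@continuous_dist R z). Qed.

Lemma plane_measurable_disc z r u : plane_measurable u ->
  plane_measurable (fun w => if Nc (w - z) <= r then u w else 0).
Proof.
move=> mu; apply: plane_measurable_if_le => //; try exact: plane_measurable_cst.
exact: plane_measurable_dist.
Qed.

Lemma plane_int_square a b l M : 0 <= l -> 0 <= M ->
  plane_int (fun z => if (complex.Re z \in `[a, a + l]) && (complex.Im z \in `[b, b + l])
                      then M else 0) = (M * l ^+ 2)%:E.
Proof.
move=> l0 M0; pose D : set plane := `[a, a + l]%classic `*` `[b, b + l]%classic.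
have mD : measurable D by apply: measurableX; exact: measurable_itv.
transitivity (\int[@area R]_(x in D) M%:E)%E.
  rewrite integral_mkcond; apply: eq_integral => w _; rewrite /patch.
  have -> : (w \in D) = (w.1 \in `[a, a + l]) && (w.2 \in `[b, b + l]).
    by apply/idP/andP => [/set_mem []|[w1 w2]]; [split|apply/mem_set; split].
  by case: ifP.
by rewrite (@integral_cst _ _ _ _ D mD) [X in (_ * X)%E](area_square _ _ l0) -EFinM.
Qed.

Lemma square_measurable a b l M :
  plane_measurable (fun z => if (complex.Re z \in `[a, a + l]) && (complex.Im z \in `[b, b + l])
                      then M else 0).
Proof.
have mRe : plane_measurable (fun z => complex.Re z) by exact: continuous_plane_measurable continuous_Re.
have mIm : plane_measurable (fun z => complex.Im z) by exact: continuous_plane_measurable continuous_Im.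
rewrite (_ : (fun z => _) = fun z => if a <= complex.Re z then
    if complex.Re z <= a + l then if b <= complex.Im z then
    if complex.Im z <= b + l then M else 0 else 0 else 0 else 0); last first.
  by apply/funext => z; rewrite !in_itv /=; do 4 (case: (_ <= _) => //=).
by do ?[exact: plane_measurable_cst|exact: mRe|exact: mIm|apply: plane_measurable_if_le].
Qed.

Lemma plane_int_disc_le z r M : 0 <= r -> 0 <= M ->
  (plane_int (fun w => if (Nc (w - z) <= r)%R then M else 0%R) <= (M * (4 * r ^+ 2))%:E)%E.
Proof.
move=> r0 M0.
have l0 : 0 <= 2 * r by rewrite mulr_ge0.
have -> : 4 * r ^+ 2 = (2 * r) ^+ 2 by ring.
rewrite -(plane_int_square (complex.Re z - r) (complex.Im z - r) l0 M0).
apply: le_plane_int; [exact: (plane_measurable_disc z r (plane_measurable_cst M))|exact: square_measurable|].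
move=> w; case: ifP => wz; last by rewrite lexx /=; case: ifP.
rewrite M0 /= ifT // !in_itv /=.
have := le_trans (Re_le_normc _) wz; have := le_trans (Im_le_normc _) wz.
rewrite !raddfB /= !ler_norml => /andP [? ?] /andP [? ?].
by apply/andP; split; apply/andP; split; lra.
Qed.

Lemma plane_int_disc_ge z r M : 0 <= r -> 0 <= M ->
  ((M * r ^+ 2)%:E <= plane_int (fun w => if (Nc (w - z) <= r)%R then M else 0%R))%E.
Proof.
move=> r0 M0.
rewrite -(plane_int_square (complex.Re z - r / 2) (complex.Im z - r / 2) r0 M0).
apply: le_plane_int; [exact: square_measurable|exact: (plane_measurable_disc z r (plane_measurable_cst M))|].
move=> w; case: ifP => wz; last by rewrite lexx /=; case: ifP.
rewrite M0 /= ifT //; apply: le_trans (normc_le_ReIm _) _.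
rewrite !raddfB /= (splitr r); move: wz; rewrite !in_itv /=.
move=> /andP [/andP [? ?] /andP [? ?]]; apply: lerD; rewrite ler_norml; apply/andP; split; lra.
Qed.

Lemma area_sigma_finite : sigma_finite [set: plane] (@area R).
Proof.
pose S n : set plane := `[- n%:R, - n%:R + 2 * n%:R]%classic `*` `[- n%:R, - n%:R + 2 * n%:R]%classic.
exists S => [|n]; last first.
  split; first by apply: measurableX; exact: measurable_itv.
  by rewrite [X in (X < _)%E]area_square ?ltry // mulr_ge0.
apply/seteqP; split=> // -[x y] _; pose n := maxn (Num.bound `|x|) (Num.bound `|y|).
exists n => //; have bd (t : R) : (Num.bound `|t| <= n)%N -> `[- n%:R, - n%:R + 2 * n%:R]%classic t.
  move=> tn; have : `|t| <= n%:R.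
    by apply: ltW; apply: lt_le_trans (_ : (Num.bound `|t|)%:R <= _); [exact: archi_boundP|rewrite ler_nat].
  by rewrite /= in_itv /= ler_norml => /andP [? ?]; apply/andP; split; lra.
by split; apply: bd; rewrite /n ?leq_maxl ?leq_maxr.
Qed.

(** The measure [area R] under a name to which a sigma-finite structure can be
    attached. *)
Definition area_fun : set plane -> \bar R := @area R.
HB.instance Definition _ := Measure.copy area_fun (@area R).
HB.instance Definition _ := Measure_isSigmaFinite.Build _ _ _ area_fun area_sigma_finite.
Let area_sf : {sigma_finite_measure set plane -> \bar R} := area_fun.

Lemma plane_tonelli (K : R[i] -> R[i] -> R) :
  joint_measurable K -> (forall z w, 0 <= K z w) ->
  (\int[@area R]_z plane_int (fun w => K (of_plane z) w) =
   \int[@area R]_w plane_int (fun z => K z (of_plane w)))%E.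
Proof.
move=> mK K0; have := @fubini_tonelli _ _ _ _ _ area_sf area_sf
  (fun v : plane * plane => (K (of_plane v.1) (of_plane v.2))%:E).
apply; first exact/measurable_EFinP.
by move=> v; rewrite lee_fin.
Qed.

Lemma plane_int_inner_measurable (K : R[i] -> R[i] -> R) :
  joint_measurable K -> (forall z w, 0 <= K z w) ->
  measurable_fun [set: plane] (fun z : plane => plane_int (fun w => K (of_plane z) w)).
Proof.
move=> mK K0; have := @measurable_fun_fubini_tonelli_F _ _ _ _ _ area_sf
  (fun v : plane * plane => (K (of_plane v.1) (of_plane v.2))%:E).
apply; first exact/measurable_EFinP.
by move=> v; rewrite lee_fin.
Qed.

Lemma joint_measurable_l u : plane_measurable u -> joint_measurable (fun z _ => u z).
Proof. by move=> mu; exact: (measurableT_comp mu measurable_fst). Qed.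

Lemma joint_measurable_r u : plane_measurable u -> joint_measurable (fun _ w => u w).
Proof. by move=> mu; exact: (measurableT_comp mu measurable_snd). Qed.

Lemma joint_measurable_dist : joint_measurable (fun z w => Nc (w - z)).
Proof.
have sq (f : plane * plane -> measurableTypeR R) : measurable_fun [set: plane * plane] f ->
    measurable_fun [set: plane * plane] (fun q : plane * plane => f q ^+ 2 : measurableTypeR R).
  by move=> mf; exact: measurable_funX.
have mfst1 : measurable_fun [set: plane * plane] (fun v : plane * plane => v.1.1).
  exact: (measurableT_comp measurable_fst measurable_fst).
have mfst2 : measurable_fun [set: plane * plane] (fun v : plane * plane => v.1.2).
  exact: (measurableT_comp measurable_snd measurable_fst).
have msnd1 : measurable_fun [set: plane * plane] (fun v : plane * plane => v.2.1).
  exact: (measurableT_comp measurable_fst measurable_snd).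
have msnd2 : measurable_fun [set: plane * plane] (fun v : plane * plane => v.2.2).
  exact: (measurableT_comp measurable_snd measurable_snd).
apply: (measurableT_comp (f := @Num.sqrt R)
  (g := fun v : plane * plane => (v.2.1 - v.1.1) ^+ 2 + (v.2.2 - v.1.2) ^+ 2)).
  by apply: continuous_measurable_fun; exact: sqrt_continuous.
by apply: measurable_funD; apply: sq; exact: measurable_funB.
Qed.

(** Up to a constant, integrating this kernel in w averages U over the disc of
    centre z and radius [a / (1 + |z|)], when z lies outside the disc of radius
    rho. *)
Definition disc_kernel (rho a : R) (U : R[i] -> R) (z w : R[i]) : R :=
  if (rho <= Nc z) && (Nc (w - z) <= a / (1 + Nc z)) then (1 + Nc z) ^+ 2 * U w else 0.

Lemma disc_kernel_ge0 rho a U z w : (forall w, 0 <= U w) -> 0 <= disc_kernel rho a U z w.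
Proof.
by move=> U0; rewrite /disc_kernel; case: ifP => // _; rewrite mulr_ge0 ?sqr_ge0.
Qed.

Lemma disc_kernel_le rho a U z w : 0 < a -> 2 * a <= 1 + rho -> (forall w, 0 <= U w) ->
  disc_kernel rho a U z w <=
    if Nc (z - w) <= 2 * a / (1 + Nc w) then 4 * (1 + Nc w) ^+ 2 * U w else 0.
Proof.
move=> a0 arho U0; rewrite /disc_kernel.
have Nw0 : 0 < 1 + Nc w by rewrite ltr_pwDl // normc_ge0.
have M0 : 0 <= 4 * (1 + Nc w) ^+ 2 * U w.
  exact: mulr_ge0 (mulr_ge0 (ler0n _ 4) (sqr_ge0 _)) (U0 w).
case: ifP => [/andP [rz wz]|_]; last by case: ifP.
have Nz0 : 0 < 1 + Nc z by rewrite ltr_pwDl // normc_ge0.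
have half : a / (1 + Nc z) <= 1 / 2.
  rewrite ler_pdivrMr //; apply: le_trans (_ : (1 + rho) / 2 <= _); first by lra.
  by rewrite mul1r mulrC ler_pM2l ?lerD2l // invr_gt0.
have zw := le_trans (ler_dist_normc w z) (le_trans wz half).
move: zw; rewrite ler_norml => /andP [zw1 zw2].
rewrite ifT.
  rewrite ler_wpM2r // -[4](_ : 2 ^+ 2 = _); last by rewrite -natrX.
  rewrite -exprMn lerXn2r ?nnegrE ?mulr_ge0 ?(ltW Nz0) ?(ltW Nw0) //.
  have := normc_ge0 z; have := normc_ge0 w; lra.
rewrite normc_distC; apply: le_trans wz _.
rewrite ler_pdivrMr // mulrAC ler_pdivlMr // [2 * a]mulrC -mulrA ler_pM2l //.
have := normc_ge0 z; have := normc_ge0 w; lra.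
Qed.

Lemma disc_kernel_measurable rho a U : plane_measurable U ->
  joint_measurable (disc_kernel rho a U).
Proof.
move=> mU; rewrite /joint_measurable /disc_kernel.
have m1 : plane_measurable (fun z => 1 + Nc z).
  by apply: plane_measurableD; [exact: plane_measurable_cst|exact: plane_measurable_normc].
have mV : plane_measurable (fun z => a / (1 + Nc z)).
  apply: plane_measurableM; first exact: plane_measurable_cst.
  apply: continuous_plane_measurable => z.
  apply: (@continuousV R R[i] (fun z => 1 + Nc z : R) z).
    by rewrite gt_eqF // ltr_pwDl // normc_ge0.
  apply: (@continuousD R R R[i]); [exact: cst_continuous|exact: continuous_normc].
apply: measurable_fun_ifT.
- apply: measurable_and.
    apply: measurable_fun_ler; first exact: measurable_cst.
    exact: (joint_measurable_l plane_measurable_normc).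
  apply: measurable_fun_ler; first exact: joint_measurable_dist.
  exact: (joint_measurable_l mV).
- apply: measurable_funM; last exact: (joint_measurable_r mU).
  apply: measurable_funX; exact: (joint_measurable_l m1).
- exact: measurable_cst.
Qed.

(** By Tonelli, it suffices to integrate the kernel in z.  The radii vary slowly,
    so the discs containing w are centred in the disc of twice the radius around
    w, and the factor [(1 + |z|)^2] compensates the area of the latter. *)
Lemma disc_kernel_int_le rho a U : 0 < a -> 2 * a <= 1 + rho ->
  plane_measurable U -> (forall w, 0 <= U w) ->
  (\int[@area R]_z plane_int (disc_kernel rho a U (of_plane z)) <=
     (64 * a ^+ 2)%:E * plane_int U)%E.
Proof.
move=> a0 arho mU U0.
have mK := disc_kernel_measurable rho a mU.
have K0 z w : 0 <= disc_kernel rho a U z w by exact: disc_kernel_ge0.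
pose F := (fun q : plane * plane =>
  disc_kernel rho a U (of_plane q.1) (of_plane q.2) : measurableTypeR R).
have mK' : joint_measurable (fun w z => disc_kernel rho a U z w).
  have ms : measurable_fun [set: plane * plane] (fun q : plane * plane => (q.2, q.1)).
    exact: measurable_fun_pair measurable_snd measurable_fst.
  have H : measurable_fun [set: plane * plane] (F \o (fun q : plane * plane => (q.2, q.1))).
    by apply: measurableT_comp ms; exact: mK.
  exact H.
rewrite [leLHS](plane_tonelli mK K0) -plane_intZ //; last by rewrite mulr_ge0 // sqr_ge0.
apply: ge0_le_integral => //.
- by move=> w _; apply: plane_int_ge0.
- exact: (plane_int_inner_measurable mK' (fun w z => K0 z w)).
- by apply/measurable_EFinP; exact: (plane_measurableM (plane_measurable_cst _) mU).
move=> p _; set w := of_plane p.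
have Nw0 : 0 < 1 + Nc w by rewrite ltr_pwDl // normc_ge0.
have M0 : 0 <= 4 * (1 + Nc w) ^+ 2 * U w.
  exact: mulr_ge0 (mulr_ge0 (ler0n _ 4) (sqr_ge0 _)) (U0 w).
apply: le_trans (_ : (plane_int (fun z => if (Nc (z - w) <= 2 * a / (1 + Nc w))%R
    then (4 * (1 + Nc w) ^+ 2 * U w)%R else 0%R) <= _)%E).
  apply: le_plane_int.
  - have ms : measurable_fun [set: plane] (fun q : plane => (q, p)).
      exact: measurable_fun_pair (@measurable_id _ _ _) (measurable_cst p).
    have H : measurable_fun [set: plane] (F \o (fun q : plane => (q, p))).
      by apply: measurableT_comp ms; exact: mK.
    exact H.
  - exact: (plane_measurable_disc w _ (plane_measurable_cst _)).
  by move=> z; rewrite K0 /= disc_kernel_le.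
apply: le_trans (plane_int_disc_le _ _ _) _.
- by rewrite divr_ge0 ?mulr_ge0 ?ltW.
- exact: M0.
rewrite lee_fin le_eqVlt; apply/orP; left; apply/eqP.
by field; rewrite gt_eqF.
Qed.

End PlaneIntegral.

(** * Pointwise estimates for weighted entire functions *)

Section PointwiseEstimates.
Context {R : realType}.
Implicit Types (z w v : R[i]) (a c r p : R) (k : nat) (g : R[i] -> R[i]).

Definition fock_weight k z : R := (1 + Nc z) ^+ k * expR (- (Nc z ^+ 2 / 2)).
Definition weighted k g z : R := fock_weight k z * Nc (g z).

Lemma normc_1D_gt0 z : 0 < 1 + Nc z.
Proof. by rewrite ltr_pwDl // normc_ge0. Qed.

Lemma fock_weight_gt0 k z : 0 < fock_weight k z.
Proof. by rewrite mulr_gt0 ?expR_gt0 // exprn_gt0 // normc_1D_gt0. Qed.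

Lemma weighted_ge0 k g z : 0 <= weighted k g z.
Proof. by rewrite mulr_ge0 ?normc_ge0 // ltW // fock_weight_gt0. Qed.

Lemma small_radius z a : 2 * a <= 1 + Nc z -> a / (1 + Nc z) <= 1 / 2.
Proof. by move=> az; rewrite ler_pdivrMr ?normc_1D_gt0 //; lra. Qed.

(** On a disc of radius [a / (1 + |z|)] the squared modulus varies by a bounded
    amount, so the Gaussian weight is constant up to a factor. *)
Lemma fock_weight_compare k z v w a : 0 < a -> 2 * a <= 1 + Nc z ->
  Nc (v - z) <= a / (1 + Nc z) -> Nc (w - z) <= a / (1 + Nc z) ->
  fock_weight k v <= 3 ^+ k * expR (3 * a) * fock_weight k w.
Proof.
move=> a0 az vz wz; have Nz0 := normc_1D_gt0 z.
have half := small_radius az; set d := a / (1 + Nc z) in vz wz half.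
have := le_trans (ler_dist_normc v z) vz; rewrite ler_norml => /andP [v1 v2].
have := le_trans (ler_dist_normc w z) wz; rewrite ler_norml => /andP [w1 w2].
have z0 := normc_ge0 z; have v0 := normc_ge0 v; have w0 := normc_ge0 w.
rewrite /fock_weight mulrACA -exprMn -expRD.
apply: ler_pM; [by rewrite exprn_ge0 // ltW // normc_1D_gt0|exact: expR_ge0| |].
  rewrite lerXn2r ?nnegrE ?addr_ge0 ?mulr_ge0 ?addr_ge0 //; lra.
rewrite ler_expR.
have da : d * (1 + Nc z) = a by rewrite /d mulfVK // gt_eqF.
have d0 : 0 <= d by rewrite divr_ge0 // ltW.
have : (Nc w - Nc v) * (Nc w + Nc v) <= 6 * a.
  apply: le_trans (_ : 2 * d * (3 * (1 + Nc z)) <= _); last by rewrite -da; lra.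
  have [wv|wv] := leP (Nc w) (Nc v).
    apply: (@le_trans _ _ 0); first by rewrite mulr_le0_ge0 ?addr_ge0 // subr_le0.
    exact: mulr_ge0 (mulr_ge0 (ler0n _ 2) d0) (mulr_ge0 (ler0n _ 3) (ltW Nz0)).
  by apply: ler_pM; lra.
rewrite -subr_sqr; lra.
Qed.

(** Moving inwards by about [c / |z|] lowers [|z|^2] by about [c], which gains
    the exponential factor. *)
Lemma fock_weight_inward k z w c : 0 < c -> 6 * c <= 1 + Nc z -> 1 <= Nc z ->
  Nc (w - z) <= 3 * c / (1 + Nc z) -> Nc w <= Nc z - c / (1 + Nc z) ->
  fock_weight k z <= 2 ^+ k * expR (- (c / 4)) * fock_weight k w.
Proof.
move=> c0 cz z1 wz wc; have Nz0 := normc_1D_gt0 z.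
have half : 3 * c / (1 + Nc z) <= 1 / 2 by apply: small_radius; lra.
have := le_trans (ler_dist_normc w z) (le_trans wz half); rewrite ler_norml => /andP [w1 w2].
have w0 := normc_ge0 w.
rewrite /fock_weight mulrACA -exprMn -expRD.
apply: ler_pM; [by rewrite exprn_ge0 // ltW|exact: expR_ge0| |].
  rewrite lerXn2r ?nnegrE ?addr_ge0 ?mulr_ge0 ?addr_ge0 //; lra.
rewrite ler_expR.
set d := c / (1 + Nc z) in wc.
have dc : d * (1 + Nc z) = c by rewrite /d mulfVK // gt_eqF.
have d0 : 0 <= d by rewrite divr_ge0 // ltW.
have : d * ((1 + Nc z) / 2) <= (Nc z - Nc w) * (Nc z + Nc w).
  by apply: ler_pM; lra.
rewrite mulrA dc -subr_sqr; lra.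
Qed.

(** The Cauchy estimate on a disc of radius [1 / (1 + |z|)] costs a factor
    [1 + |z|], that is, one power in the weight. *)
Lemma weighted_derive_le k g z : entire g -> 2 <= 1 + Nc z ->
  exists2 v, Nc (v - z) <= 1 / (1 + Nc z) &
    weighted k (g^`()%classic) z <= 2 * 3 ^+ k.+1 * expR 3 * weighted k.+1 g v.
Proof.
move=> eg z2; have Nz0 := normc_1D_gt0 z.
have r0 : 0 < 1 / (1 + Nc z) by rewrite divr_gt0.
have cg := continuous_normc_comp (entire_continuous eg).
have [v vz vmax] := disc_max z (ltW r0) cg; exists v => //.
have := cauchy_estimate eg r0 vmax; rewrite div1r invrK => g'z.
apply: (@le_trans _ _ (2 * fock_weight k.+1 z * Nc (g v))).
  have -> : 2 * fock_weight k.+1 z * Nc (g v) = fock_weight k z * (2 * Nc (g v) * (1 + Nc z)).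
    by rewrite /fock_weight exprS; ring.
  by rewrite ler_pM2l // fock_weight_gt0.
have -> : 2 * 3 ^+ k.+1 * expR 3 * weighted k.+1 g v =
    2 * (3 ^+ k.+1 * expR (3 * 1) * fock_weight k.+1 v) * Nc (g v).
  by rewrite /weighted mulr1; ring.
rewrite ler_wpM2r ?normc_ge0 // ler_pM2l //.
have zz : Nc (z - z) <= 1 / (1 + Nc z) by rewrite subrr Normc.normc0 ltW.
by apply: (fock_weight_compare k.+1 ltr01 _ zz vz); rewrite mulr1.
Qed.

(** Mean value inequality on the segment from z to w: its length is of order
    [1 / (1 + |z|)], which saves one power in the term with the derivative, and
    the inward position of w makes the factor of the other term small. *)
Lemma weighted_primitive_le k g z c : entire g -> 0 < c -> 6 * c <= 1 + Nc z -> 1 <= Nc z ->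
  exists2 v, Nc (v - z) <= 3 * c / (1 + Nc z) &
    forall w, Nc (w - z) <= 3 * c / (1 + Nc z) -> Nc w <= Nc z - c / (1 + Nc z) ->
    weighted k.+1 g z <= 2 ^+ k.+1 * expR (- (c / 4)) * weighted k.+1 g w +
      3 * c * 3 ^+ k * expR (9 * c) * weighted k (g^`()%classic) v.
Proof.
move=> eg c0 cz z1; have Nz0 := normc_1D_gt0 z.
have r0 : 0 < 3 * c / (1 + Nc z) by rewrite divr_gt0 // mulr_gt0.
have eg' := entire_derive1 eg.
have cg := continuous_normc_comp (entire_continuous eg').
have [v vz vmax] := disc_max z (ltW r0) cg; exists v => // w wz wc.
have gw : Nc (g z) <= Nc (g w) + Nc (g^`()%classic v) * (3 * c / (1 + Nc z)).
  rewrite -lerBlDl; apply: le_trans (ler_normcB _ _) _; rewrite normc_distC.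
  have := @normc_MVT _ g (g^`()%classic) z (w - z) (Nc (g^`()%classic v)).
  rewrite [z + (w - z)]addrC subrK => MV; apply: le_trans (MV _) _.
    move=> t /andP [t0 t1]; split; first exact: entire_is_derive.
    apply: vmax; rewrite addrAC subrr add0r Normc.normcM normc_real ger0_norm //.
    by apply: le_trans wz; rewrite ler_piMl // normc_ge0.
  by rewrite ler_wpM2l // normc_ge0.
apply: le_trans (ler_wpM2l (ltW (fock_weight_gt0 k.+1 z)) gw) _.
rewrite mulrDr; apply: lerD.
  rewrite /weighted mulrA ler_wpM2r ?normc_ge0 //.
  exact: fock_weight_inward.
have -> : fock_weight k.+1 z * (Nc (g^`()%classic v) * (3 * c / (1 + Nc z))) =
    (3 * c) * (fock_weight k z * Nc (g^`()%classic v)).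
  by rewrite /fock_weight exprS; field; rewrite gt_eqF.
have zz : Nc (z - z) <= 3 * c / (1 + Nc z) by rewrite subrr Normc.normc0 ltW.
have c30 : 0 < 3 * c by rewrite mulr_gt0.
have cmp : fock_weight k z <= 3 ^+ k * expR (3 * (3 * c)) * fock_weight k v.
  by apply: (fock_weight_compare k c30 _ zz vz); lra.
have -> : 3 * c * 3 ^+ k * expR (9 * c) * weighted k (g^`()%classic) v =
    (3 * c) * ((3 ^+ k * expR (3 * (3 * c)) * fock_weight k v) * Nc (g^`()%classic v)).
  by rewrite /weighted (_ : 9 * c = 3 * (3 * c)); ring.
by rewrite ler_pM2l // ler_wpM2r ?normc_ge0.
Qed.

(** The inward region of the previous lemma contains a disc whose area is
    comparable with that of the whole disc, uniformly in c. *)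
Lemma inward_disc z w c : 0 < c -> 6 * c <= 1 + Nc z -> 1 <= Nc z ->
  Nc (w - (z - (2 * c / (1 + Nc z) / Nc z)%:C * z)) <= c / (1 + Nc z) ->
  Nc (w - z) <= 3 * c / (1 + Nc z) /\ Nc w <= Nc z - c / (1 + Nc z).
Proof.
move=> c0 cz z1; have Nz0 := normc_1D_gt0 z.
set d := c / (1 + Nc z).
have -> : 2 * c / (1 + Nc z) = 2 * d by rewrite /d mulrA.
have -> : 3 * c / (1 + Nc z) = 3 * d by rewrite /d mulrA.
have z0 : 0 < Nc z by lra.
have d0 : 0 < d by rewrite divr_gt0.
have half : d <= 1 / 6 by rewrite /d ler_pdivrMr //; lra.
set s := (2 * d / Nc z)%:C * z => ws.
have Ns : Nc s = 2 * d.
  rewrite /s Normc.normcM normc_real ger0_norm; last by apply: divr_ge0; lra.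
  by rewrite mulfVK // gt_eqF.
split.
  have -> : w - z = (w - (z - s)) + - s by ring.
  by apply: le_trans (le_normcD _ _) _; rewrite normcN Ns; lra.
have Nzs : Nc (z - s) = Nc z - 2 * d.
  have -> : z - s = (1 - 2 * d / Nc z)%:C * z by rewrite /s raddfB mulrBl mul1r.
  rewrite Normc.normcM normc_real ger0_norm; last first.
    by rewrite subr_ge0 ler_pdivrMr //; lra.
  by rewrite mulrBl mul1r mulfVK // gt_eqF.
have := le_normcD (w - (z - s)) (z - s); rewrite subrK Nzs; lra.
Qed.

End PointwiseEstimates.

(** * Submean value inequality for powers *)

Section SubMean.
Context {R : realType}.
Implicit Types (z w v : R[i]) (a b c r p : R) (k : nat) (g : R[i] -> R[i]).

Lemma continuous_fock_weight k : continuous (fock_weight k : R[i] -> R).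
Proof.
have c1 : continuous (fun z : R[i] => 1 + Nc z).
  by move=> z; apply: (@continuousD R R R[i]); [exact: cst_continuous|exact: continuous_normc].
have cX n : continuous (fun z : R[i] => (1 + Nc z) ^+ n).
  elim: n => [|n ih] z; first by under eq_fun do rewrite expr0; exact: cst_continuous.
  by under eq_fun do rewrite exprS; exact: (continuousM (c1 z) (ih z)).
have cNN : continuous (fun z : R[i] => Nc z * Nc z).
  move=> z; have cz := @continuous_normc R z.
  exact: (@continuousM R R[i] _ _ z cz cz).
have cq2 : continuous (fun z : R[i] => 2^-1 * (Nc z * Nc z)).
  pose h : R := 2^-1; rewrite -/h => z.
  exact: (@continuousM R R[i] (fun=> h) (fun z => Nc z * Nc z) z
    (@cst_continuous _ _ h z) (cNN z)).
have cq : continuous (fun z : R[i] => - (Nc z * Nc z / 2)).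
  move=> z; under eq_fun do rewrite [_ / 2]mulrC.
  exact: (@continuousN R R R[i] (fun z => 2^-1 * (Nc z * Nc z)) z (cq2 z)).
have ce : continuous (fun z : R[i] => expR (- (Nc z * Nc z / 2))).
  move=> z; exact: (@continuous_comp R[i] R R (fun z => - (Nc z * Nc z / 2)) (@expR R) z
    (cq z) (@continuous_expR R _)).
by move=> z; rewrite /fock_weight; under eq_fun do rewrite expr2; exact: (continuousM (cX k z) (ce z)).
Qed.

Lemma continuous_weighted k g : entire g -> continuous (weighted k g).
Proof.
move=> eg z; have cg := continuous_normc_comp (entire_continuous eg).
exact: (@continuousM R R[i] (fock_weight k) (fun z => Nc (g z)) z
  (@continuous_fock_weight k z) (cg z)).
Qed.

Lemma disc_kernel_measurable_l rho a (U : R[i] -> R) z : plane_measurable U ->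
  plane_measurable (disc_kernel rho a U z).
Proof.
move=> mU; rewrite /disc_kernel; case: (rho <= Nc z) => /=; last exact: plane_measurable_cst.
exact: (plane_measurable_disc z _ (plane_measurableM (plane_measurable_cst _) mU)).
Qed.

(** Replacing g by a maximiser of [(r - |w - z|)^N |g w|] makes g comparable
    with its value at w on a whole disc around w; the Cauchy estimate then
    keeps [|g|] above half of that value on a fixed fraction of the disc.  The
    exponent N is chosen with [N p >= 2] so that the loss in radius is paid
    for by the area. *)
Lemma submean_value p : 0 < p -> exists2 C : R, 0 < C &
  forall g z r, entire g -> 0 < r ->
  ((r ^+ 2 * Nc (g z) `^ p)%:E <=
    C%:E * plane_int (fun w => if (Nc (w - z) <= r)%R then (Nc (g w) `^ p)%R else 0%R))%E.
Proof.
move=> p0; pose N := (Num.bound (2 / p)).+1.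
have Np : 2 <= N%:R * p.
  rewrite -ler_pdivrMr //; apply/ltW/(lt_le_trans (archi_boundP _)).
    by rewrite divr_ge0 // ltW.
  by rewrite ler_nat.
(* The Cauchy estimate gives a derivative below [2^(N+2) |g w| / rho] near the
   maximiser w; over a distance [e rho] this changes g by at most half. *)
pose e : R := (2 ^+ N.+3)^-1.
have e0 : 0 < e by rewrite invr_gt0 exprn_gt0.
have e1 : e <= 1 / 2.
  rewrite /e div1r lef_pV2 ?posrE ?exprn_gt0 //.
  by rewrite -[leLHS]expr1 ler_weXn2l // ler1n.
pose C := 4 * 2 `^ p / e ^+ 2.
have C0 : 0 < C by rewrite divr_gt0 ?mulr_gt0 ?powR_gt0 ?exprn_gt0.
exists C => // g z r eg r0.
have cN := continuous_normc_comp (entire_continuous eg).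
have mg := plane_measurable_powR p (continuous_plane_measurable cN).
have int0 : (0 <= plane_int (fun w => if (Nc (w - z) <= r)%R then (Nc (g w) `^ p)%R else 0%R))%E.
  by apply: plane_int_ge0 => w; case: ifP => // _; exact: powR_ge0.
have [gz0|gzn0] := eqVneq (g z) 0.
  rewrite gz0 Normc.normc0 powR0 ?gt_eqF // mulr0.
  by apply: mule_ge0 => //; rewrite lee_fin ltW.
pose Phi w := (r - Nc (w - z)) ^+ N * Nc (g w).
have cPhi : continuous Phi.
  have cdist := @continuous_dist R z.
  have cd : continuous (fun w : R[i] => r - Nc (w - z)).
    move=> w; exact: (@continuousB R R R[i] (fun=> r) (fun w => Nc (w - z)) w
      (@cst_continuous _ _ r w) (cdist w)).
  have cX n : continuous (fun w : R[i] => (r - Nc (w - z)) ^+ n).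
    elim: n => [|n ih] w; first by under eq_fun do rewrite expr0; exact: cst_continuous.
    by under eq_fun do rewrite exprS; exact: (continuousM (cd w) (ih w)).
  by move=> w; exact: (continuousM (cX N w) (cN w)).
have [w wr wmax] := disc_max z (ltW r0) cPhi.
have Phiz : r ^+ N * Nc (g z) <= Phi w.
  by have := wmax z; rewrite /Phi subrr Normc.normc0 subr0; apply; exact: ltW.
have Phiw : 0 < Phi w.
  by apply: lt_le_trans Phiz; rewrite mulr_gt0 ?exprn_gt0 ?normc_gt0.
have wlt : Nc (w - z) < r.
  rewrite lt_neqAle wr andbT; apply/eqP => wE; move: Phiw.
  by rewrite /Phi wE subrr expr0n mul0r ltxx.
pose rho := (r - Nc (w - z)) / 2.
have rho0 : 0 < rho by rewrite divr_gt0 // subr_gt0.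
have rhoE : r - Nc (w - z) = 2 * rho by rewrite /rho mulrC divfK.
clearbody rho.
set G := Nc (g w).
have PhiE : Phi w = (2 * rho) ^+ N * G by rewrite /Phi rhoE.
have G0 : 0 < G.
  by move: Phiw; rewrite PhiE pmulr_rgt0 // exprn_gt0 // mulr_gt0.
have big v : Nc (v - w) <= rho -> Nc (v - z) <= r - rho.
  move=> vw; have -> : v - z = (v - w) + (w - z) by ring.
  by apply: le_trans (le_normcD _ _) _; move: rhoE vw; lra.
have bound v : Nc (v - w) <= rho -> Nc (g v) <= 2 ^+ N * G.
  move=> vw; have vz := big v vw.
  have : rho ^+ N * Nc (g v) <= (2 * rho) ^+ N * G.
    rewrite -PhiE; apply: le_trans (wmax v _); last by apply: le_trans vz _; lra.
    rewrite ler_wpM2r ?normc_ge0 // lerXn2r ?nnegrE; lra.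
  have -> : (2 * rho) ^+ N * G = rho ^+ N * (2 ^+ N * G) by rewrite exprMn; ring.
  by rewrite ler_pM2l // exprn_gt0.
have bound' v : Nc (v - w) <= rho / 2 -> Nc (g^`()%classic v) <= 2 ^+ N.+2 * G / rho.
  move=> vw; have r20 : 0 < rho / 2 by rewrite divr_gt0.
  have := @cauchy_estimate _ g v (rho / 2) (2 ^+ N * G) eg r20.
  have -> : 2 * (2 ^+ N * G) / (rho / 2) = 2 ^+ N.+2 * G / rho.
    by rewrite !exprS; field; rewrite gt_eqF.
  apply=> u uv; apply: bound; rewrite (_ : u - w = (u - v) + (v - w)); last by ring.
  by apply: le_trans (le_normcD _ _) _; lra.
have erho : e * rho <= rho / 2 by rewrite mulrC ler_pM2l // -div1r.
have half v : Nc (v - w) <= e * rho -> G / 2 <= Nc (g v).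
  move=> vw; have := @normc_MVT _ g (g^`()%classic) w (v - w) (2 ^+ N.+2 * G / rho).
  rewrite [w + (v - w)]addrC subrK => MV.
  have {}MV : Nc (g v - g w) <= G / 2.
    apply: le_trans (MV _) _.
      move=> t /andP [t0 t1]; split; first exact: entire_is_derive.
      apply: bound'; rewrite addrAC subrr add0r Normc.normcM normc_real ger0_norm //.
      by apply: le_trans (le_trans vw erho); rewrite ler_piMl // normc_ge0.
    apply: le_trans (ler_wpM2l _ vw) _.
      by apply: divr_ge0 (mulr_ge0 _ (ltW G0)) (ltW rho0); exact: exprn_ge0.
    rewrite le_eqVlt; apply/orP; left; apply/eqP; rewrite /e !exprS.
    by field; rewrite expf_neq0 // gt_eqF.
  have := ler_normcB (g w) (g v); rewrite normc_distC -/G; lra.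
have low : (((G / 2) `^ p * (e * rho) ^+ 2)%:E <=
    plane_int (fun w => if (Nc (w - z) <= r)%R then (Nc (g w) `^ p)%R else 0%R))%E.
  apply: le_trans (plane_int_disc_ge w _ (powR_ge0 _ _)) _.
    by rewrite mulr_ge0 ?ltW.
  apply: le_plane_int.
  - exact: (plane_measurable_disc w _ (plane_measurable_cst _)).
  - exact: (plane_measurable_disc z _ mg).
  move=> v; case: ifP => vw; last by rewrite lexx /=; case: ifP => // _; exact: powR_ge0.
  rewrite powR_ge0 /= ifT; last first.
    have := big v; have := le_trans vw erho; move: rho0; lra.
  apply: ge0_ler_powR; rewrite ?nnegrE ?normc_ge0 ?half ?(ltW p0) //.
  by rewrite divr_ge0 ?ltW.
apply: le_trans (lee_wpmul2l _ low); last by rewrite lee_fin ltW.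
rewrite -EFinM lee_fin.
pose t := 2 * rho / r.
have t0 : 0 < t by rewrite divr_gt0 ?mulr_gt0.
have t1 : t <= 1 by rewrite ler_pdivrMr // mul1r -rhoE lerBlDr lerDl normc_ge0.
have tN0 : 0 <= t ^+ N := exprn_ge0 N (ltW t0).
have gzt : Nc (g z) <= t ^+ N * G.
  by rewrite /t expr_div_n mulrAC ler_pdivlMr ?exprn_gt0 // mulrC -PhiE.
have -> : C * ((G / 2) `^ p * (e * rho) ^+ 2) = (2 * rho) ^+ 2 * G `^ p.
  rewrite powRM ?invr_ge0 ?(ltW G0) // -[2^-1]powR_inv1 // -powRrM mulN1r powRN.
  rewrite /C; field; rewrite !gt_eqF ?powR_gt0 //.
apply: le_trans (_ : r ^+ 2 * (t ^+ 2 * G `^ p) <= _); last first.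
  by rewrite le_eqVlt; apply/orP; left; apply/eqP; rewrite /t; field; rewrite gt_eqF.
rewrite ler_pM2l ?exprn_gt0 //.
apply: le_trans (_ : (t ^+ N * G) `^ p <= _).
  apply: ge0_ler_powR => //; rewrite ?nnegrE ?normc_ge0 ?(ltW p0) //.
  exact: mulr_ge0 tN0 (ltW G0).
rewrite powRM ?tN0 ?(ltW G0) // ler_wpM2r ?powR_ge0 //.
rewrite -[t ^+ N]powR_mulrn ?(ltW t0) // -powRrM -[t ^+ 2]powR_mulrn ?(ltW t0) //.
by apply: ger_powR; rewrite ?t0 ?t1.
Qed.

(** The submean inequality survives the weight, which is nearly constant at
    this scale. *)
Lemma weighted_local_le k b p : 0 <= b -> 0 < p -> exists2 C : R, 0 < C &
  forall rho g z v, entire g -> 2 * (b + 1) <= 1 + rho -> rho <= Nc z ->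
  Nc (v - z) <= b / (1 + Nc z) ->
  ((weighted k g v `^ p)%:E <=
     C%:E * plane_int (disc_kernel rho (b + 1) (fun w => weighted k g w `^ p)%R z))%E.
Proof.
move=> b0 p0; have [C C0 HC] := submean_value p0.
pose B := 3 ^+ k * expR (3 * (b + 1)).
have B0 : 0 < B by rewrite mulr_gt0 ?exprn_gt0 ?expR_gt0.
exists (C * B `^ p) => [|rho g z v eg brho rhoz vz].
  by rewrite mulr_gt0 ?powR_gt0.
have Nz0 := normc_1D_gt0 z; set d := (1 + Nc z)^-1.
have d0 : 0 < d by rewrite invr_gt0.
have bz : 2 * (b + 1) <= 1 + Nc z by lra.
have b10 : 0 < b + 1 by lra.
have dE : (b + 1) / (1 + Nc z) = b / (1 + Nc z) + d by rewrite mulrDl mul1r.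
have cw : continuous (weighted k g).
  exact: continuous_weighted.
have mW := plane_measurable_powR p (continuous_plane_measurable cw).
pose I := plane_int (fun w => if Nc (w - v) <= d then Nc (g w) `^ p else 0).
have cg := continuous_normc_comp (entire_continuous eg).
have mg := plane_measurable_powR p (continuous_plane_measurable cg).
have H := HC g v d eg d0.
have Wv0 := fock_weight_gt0 k v.
have mD := plane_measurable_disc v d mg.
have mK := disc_kernel_measurable_l rho (b + 1) z mW.
have Wvp : 0 <= fock_weight k v `^ p * (1 + Nc z) ^+ 2.
  by rewrite mulr_ge0 ?powR_ge0 ?sqr_ge0.
have -> : weighted k g v `^ p =
    (fock_weight k v `^ p * (1 + Nc z) ^+ 2) * (d ^+ 2 * Nc (g v) `^ p).
  rewrite /weighted powRM ?normc_ge0 ?(ltW Wv0) // /d.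
  by field; rewrite gt_eqF.
rewrite EFinM; apply: le_trans (lee_wpmul2l _ H) _; first by rewrite lee_fin.
rewrite muleA -EFinM -(plane_intZ mK); last 2 first.
- by rewrite mulr_ge0 ?powR_ge0 // ltW.
- by move=> w; apply: disc_kernel_ge0 => w'; exact: powR_ge0.
rewrite -(plane_intZ mD); last 2 first.
- by rewrite mulr_ge0 // ltW.
- by move=> w; case: ifP => // _; exact: powR_ge0.
apply: le_plane_int.
- exact: plane_measurableM (plane_measurable_cst _) mD.
- exact: plane_measurableM (plane_measurable_cst _) mK.
move=> w; have L0 : 0 <= fock_weight k v `^ p * (1 + Nc z) ^+ 2 * C.
  by rewrite mulr_ge0 // ltW.
have R0 : 0 <= C * B `^ p * disc_kernel rho (b + 1) (fun w => weighted k g w `^ p) z w.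
  rewrite mulr_ge0 ?disc_kernel_ge0 ?mulr_ge0 ?powR_ge0 ?(ltW C0) // => w'.
  exact: powR_ge0.
case: ifP => wv; last by rewrite mulr0 lexx R0.
rewrite mulr_ge0 ?powR_ge0 //= /disc_kernel.
have wz : Nc (w - z) <= (b + 1) / (1 + Nc z).
  rewrite dE (_ : w - z = (v - z) + (w - v)); last by ring.
  by apply: le_trans (le_normcD _ _) _; exact: lerD.
rewrite rhoz wz /= /weighted powRM ?normc_ge0 ?(ltW (fock_weight_gt0 _ _)) //.
have -> : fock_weight k v `^ p * (1 + Nc z) ^+ 2 * C * Nc (g w) `^ p =
   (C * (1 + Nc z) ^+ 2 * Nc (g w) `^ p) * fock_weight k v `^ p by ring.
have -> : C * B `^ p * ((1 + Nc z) ^+ 2 * (fock_weight k w `^ p * Nc (g w) `^ p)) =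
   (C * (1 + Nc z) ^+ 2 * Nc (g w) `^ p) * (B `^ p * fock_weight k w `^ p).
  by move: (B `^ p) (fock_weight k w `^ p) (Nc (g w) `^ p) => x y t; ring.
apply: ler_wpM2l; first by rewrite !mulr_ge0 ?powR_ge0 ?sqr_ge0 // ltW.
rewrite -powRM ?(ltW B0) ?(ltW (fock_weight_gt0 _ _)) //.
apply: ge0_ler_powR; rewrite ?nnegrE ?(ltW p0) ?(ltW Wv0) //.
  by rewrite mulr_ge0 ?(ltW B0) ?(ltW (fock_weight_gt0 _ _)).
apply: (fock_weight_compare k b10 bz) => //.
by rewrite dE; apply: le_trans vz _; rewrite lerDl ltW.
Qed.

End SubMean.

(** * Integrals of weighted powers: derivatives *)

Section WeightedIntegrals.
Context {R : realType}.
Implicit Types (z w v : R[i]) (a b c r p : R) (k : nat) (g : R[i] -> R[i]).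
Implicit Types (u : R[i] -> R).
Local Notation plane := (measurableTypeR R * measurableTypeR R)%type.

Definition on_disc r u z : R := if Nc z <= r then u z else 0.
Definition off_disc r u z : R := if r <= Nc z then u z else 0.

Lemma on_disc_measurable r u : plane_measurable u -> plane_measurable (on_disc r u).
Proof.
move=> mu; apply: plane_measurable_if_le => //; try exact: plane_measurable_cst.
exact: plane_measurable_normc.
Qed.

Lemma off_disc_measurable r u : plane_measurable u -> plane_measurable (off_disc r u).
Proof.
move=> mu; apply: plane_measurable_if_le => //; try exact: plane_measurable_cst.
exact: plane_measurable_normc.
Qed.

Lemma on_disc_ge0 r u z : (forall z, 0 <= u z) -> 0 <= on_disc r u z.
Proof. by move=> u0; rewrite /on_disc; case: ifP. Qed.

Lemma off_disc_ge0 r u z : (forall z, 0 <= u z) -> 0 <= off_disc r u z.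
Proof. by move=> u0; rewrite /off_disc; case: ifP. Qed.

Lemma plane_int_le_on_off r u : plane_measurable u -> (forall z, 0 <= u z) ->
  (plane_int u <= plane_int (on_disc r u) + plane_int (off_disc r u))%E.
Proof.
move=> mu u0; have m1 := on_disc_measurable r mu; have m2 := off_disc_measurable r mu.
rewrite -plane_intD //; [|by move=> z; exact: on_disc_ge0|by move=> z; exact: off_disc_ge0].
apply: le_plane_int => //; first exact: plane_measurableD.
move=> z; rewrite u0 /= /on_disc /off_disc; case: (leP (Nc z) r) => zr.
  by rewrite lerDl; case: ifP.
by rewrite (ltW zr) add0r.
Qed.

(** Monotone convergence, in the form used to pass from discs to the plane. *)
Lemma plane_int_exhaust u (B : \bar R) : plane_measurable u -> (forall z, 0 <= u z) ->
  (forall n : nat, (plane_int (on_disc n%:R u) <= B)%E) -> (plane_int u <= B)%E.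
Proof.
move=> mu u0 HB.
pose f n (q : plane) := (on_disc n%:R u (of_plane q))%:E.
have mf n : measurable_fun [set: plane] (f n).
  by apply/measurable_EFinP; exact: on_disc_measurable.
have f0 n q : [set: plane] q -> (0 <= f n q)%E.
  by move=> _; rewrite lee_fin; exact: on_disc_ge0.
have nf q : [set: plane] q -> {homo (fun n => f n q) : n m / (n <= m)%N >-> (n <= m)%E}.
  move=> _ n m nm; rewrite /f lee_fin /on_disc; case: ifP => qn; last by case: ifP.
  by rewrite ifT // (le_trans qn) // ler_nat.
have := monotone_convergence (@area R) measurableT mf f0 nf.
have -> : (\int[@area R]_(x in [set: plane]) limn (f ^~ x))%E = plane_int u.
  apply: eq_integral => q _; apply: cvg_lim => //; apply: cvg_near_cst.
  exists (Num.bound (Nc (of_plane q))) => // n /= qn; rewrite /f /on_disc ifT //.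
  apply: ltW; apply: lt_le_trans (archi_boundP (normc_ge0 _)) _.
  by rewrite ler_nat.
move=> ->; apply: lime_le; last by apply: nearW => n; exact: HB.
apply: ereal_nondecreasing_is_cvgn => n m nm; apply: ge0_le_integral => //.
- exact: f0.
- by move=> q _; exact: nf.
Qed.

(** Two kernels occur, since the estimate for primitives has one term to be
    absorbed and one term with the derivative. *)
Lemma le_disc_kernel_int u (c1 c2 rho a1 a2 : R) U1 U2 :
  0 <= c1 -> 0 <= c2 -> 0 < a1 -> 0 < a2 -> 2 * a1 <= 1 + rho -> 2 * a2 <= 1 + rho ->
  plane_measurable u -> plane_measurable U1 -> plane_measurable U2 ->
  (forall z, 0 <= u z) -> (forall z, 0 <= U1 z) -> (forall z, 0 <= U2 z) ->
  (forall z, ((u z)%:E <= c1%:E * plane_int (disc_kernel rho a1 U1 z) +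
                         c2%:E * plane_int (disc_kernel rho a2 U2 z))%E) ->
  (plane_int u <= (c1 * (64 * a1 ^+ 2))%:E * plane_int U1 +
                  (c2 * (64 * a2 ^+ 2))%:E * plane_int U2)%E.
Proof.
move=> c10 c20 a10 a20 ar1 ar2 mu mU1 mU2 u0 U10 U20 H.
have K0 a U z : (forall z, 0 <= U z) -> (0 <= plane_int (disc_kernel rho a U z))%E.
  by move=> U0; apply: plane_int_ge0 => w; exact: disc_kernel_ge0.
have mK a U : plane_measurable U -> (forall z, 0 <= U z) ->
    measurable_fun [set: plane] (fun q : plane => plane_int (disc_kernel rho a U (of_plane q))).
  move=> mU U0; apply: (plane_int_inner_measurable (disc_kernel_measurable rho a mU)).
  by move=> z w; exact: disc_kernel_ge0.
have m1 := mK a1 U1 mU1 U10; have m2 := mK a2 U2 mU2 U20.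
apply: (@le_trans _ _ (\int[@area R]_q
   (c1%:E * plane_int (disc_kernel rho a1 U1 (of_plane q)) +
    c2%:E * plane_int (disc_kernel rho a2 U2 (of_plane q))))%E).
  apply: ge0_le_integral => //.
  - by move=> q _; rewrite lee_fin.
  - exact/measurable_EFinP.
  - by apply: emeasurable_funD; exact: measurable_funeM.
rewrite ge0_integralD //; first last.
- exact: measurable_funeM.
- by move=> q _; rewrite mule_ge0 ?lee_fin ?K0.
- exact: measurable_funeM.
- by move=> q _; rewrite mule_ge0 ?lee_fin ?K0.
rewrite !ge0_integralZl_EFin //; try by move=> q _; exact: K0.
rewrite (EFinM c1) (EFinM c2) -!muleA; apply: leeD; apply: lee_wpmul2l; rewrite ?lee_fin //.
  exact: disc_kernel_int_le.
exact: disc_kernel_int_le.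
Qed.

Definition weighted_pow p k g z : R := weighted k g z `^ p.

Section FinitePower.
Variables (p : R) (p0 : 0 < p).
Local Notation wp := (weighted_pow p).

Lemma weighted_pow_measurable k g : entire g -> plane_measurable (wp k g).
Proof.
by move=> eg; exact: (plane_measurable_powR p
  (continuous_plane_measurable (@continuous_weighted _ k g eg))).
Qed.

Lemma weighted_pow_ge0 k g z : 0 <= wp k g z.
Proof. exact: powR_ge0. Qed.

Lemma ler_powR_nneg (x y : R) : 0 <= x -> x <= y -> x `^ p <= y `^ p.
Proof.
move=> x0 xy; apply: ge0_ler_powR => //; rewrite ?nnegrE ?(ltW p0) //.
exact: le_trans xy.
Qed.

Lemma on_disc_weighted_pow_lty r k g : 0 <= r -> entire g ->
  (plane_int (on_disc r (wp k g)) < +oo)%E.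
Proof.
move=> r0 eg; have [c _ cmax] := disc_max 0 r0 (@continuous_weighted _ k g eg).
apply: le_lt_trans (ltry (wp k g c * (4 * r ^+ 2))).
apply: le_trans (plane_int_disc_le 0 r0 (weighted_pow_ge0 k g c)).
apply: le_plane_int.
- exact: on_disc_measurable (weighted_pow_measurable k eg).
- exact: (plane_measurable_disc 0 r (plane_measurable_cst _)).
move=> z; rewrite on_disc_ge0 /=; last by move=> w; exact: weighted_pow_ge0.
rewrite /on_disc subr0; case: ifP => // zr.
by apply: ler_powR_nneg (weighted_ge0 _ _ _) _; apply: cmax; rewrite subr0.
Qed.

(** Off a disc, the pointwise bound of the weighted derivative by a nearby value
    of [weighted k.+1 g], followed by the local average of the latter. *)
Lemma weighted_pow_derive_lty k g : entire g ->
  (plane_int (wp k.+1 g) < +oo)%E -> (plane_int (wp k (g^`()%classic)) < +oo)%E.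
Proof.
move=> eg Ig; have eg' := entire_derive1 eg.
have [C C0 HC] := weighted_local_le k.+1 (ler01 : (0 : R) <= 1) p0.
pose D : R := 2 * 3 ^+ k.+1 * expR 3.
have D0 : 0 < D by rewrite !mulr_gt0 ?exprn_gt0 ?expR_gt0.
have mg := weighted_pow_measurable k.+1 eg; have mg' := weighted_pow_measurable k eg'.
apply: le_lt_trans (plane_int_le_on_off 3 mg' (weighted_pow_ge0 _ _)) _.
rewrite lte_add_pinfty ?on_disc_weighted_pow_lty //.
have key z : ((off_disc 3 (wp k (g^`()%classic)) z)%:E <=
    (D `^ p * C)%:E * plane_int (disc_kernel 3 2 (wp k.+1 g) z) +
    0%:E * plane_int (disc_kernel 3 2 (wp k.+1 g) z))%E.
  rewrite mul0e adde0.
  have K0 : (0 <= plane_int (disc_kernel 3 2 (wp k.+1 g) z))%E.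
    by apply: plane_int_ge0 => w; apply: disc_kernel_ge0 => w'; exact: weighted_pow_ge0.
  rewrite /off_disc; case: ifP => z3; last first.
    by rewrite mule_ge0 // lee_fin mulr_ge0 ?powR_ge0 // ltW.
  have [v vz Hv] := @weighted_derive_le _ k g z eg ltac:(lra).
  apply: (@le_trans _ _ ((D * weighted k.+1 g v) `^ p)%:E).
    by rewrite lee_fin; apply: ler_powR_nneg Hv; exact: weighted_ge0.
  rewrite powRM ?weighted_ge0 ?(ltW D0) // !EFinM -muleA.
  apply: lee_wpmul2l; first by rewrite lee_fin powR_ge0.
  have := HC 3 g z v eg ltac:(lra) z3 vz; rewrite (_ : 1 + 1 = 2) //.
have := @le_disc_kernel_int (off_disc 3 (wp k (g^`()%classic))) (D `^ p * C) 0 3 2 2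
  (wp k.+1 g) (wp k.+1 g).
move=> /(_ _ _ _ _ _ _ _ _ _ _ _ _ key) H; apply: le_lt_trans (H _ _ _ _ _ _ _ _ _ _ _ _) _ => //.
- by rewrite mulr_ge0 ?powR_ge0 // ltW.
- lra.
- lra.
- exact: off_disc_measurable.
- by move=> z; apply: off_disc_ge0 => w; exact: weighted_pow_ge0.
- by move=> z; exact: weighted_pow_ge0.
- by move=> z; exact: weighted_pow_ge0.
rewrite mul0r mul0e adde0.
have I0 : (0 <= plane_int (wp k.+1 g))%E by apply: plane_int_ge0 => z; exact: weighted_pow_ge0.
by rewrite lte_mul_pinfty // ?lee_fin ?mulr_ge0 ?powR_ge0 ?(ltW C0) //.
Qed.

End FinitePower.
End WeightedIntegrals.

(** * Integrals of weighted powers: primitives *)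

Section PrimitiveIntegral.
Context {R : realType}.
Variables (p : R) (p0 : 0 < p).
Implicit Types (z w v : R[i]) (k : nat) (g : R[i] -> R[i]).
Local Notation wp := (weighted_pow p).

Lemma large_shift (K : R) : 0 <= K ->
  exists2 c : R, 1 <= c & K * expR (- (c / 4)) `^ p <= 1 / 2.
Proof.
move=> K0; exists (8 * K / p + 1).
  by rewrite lerDr divr_ge0 ?mulr_ge0 // ltW.
rewrite -expRM (_ : - _ * p = - (2 * K + p / 4)); last by field; rewrite gt_eqF.
rewrite expRN ler_pdivrMr ?expR_gt0 //.
have p40 : 0 <= p / 4 by rewrite divr_ge0 // ltW.
have := expR_ge1Dx (2 * K + p / 4); move: (expR _) p40 => y; lra.
Qed.

(** Either the derivative controls [weighted k.+1 g z], or all the values of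
    [weighted k.+1 g] at the points of the inward part of the disc do, and then
    so does their average.  These points have smaller modulus than z, so the
    truncation to the disc of radius rad is harmless. *)
Lemma weighted_pow_primitive_kernel_le k c : 1 <= c -> exists2 C : R, 0 <= C &
  forall g rad z, entire g ->
  ((off_disc (6 * c + 1) (on_disc rad (wp k.+1 g)) z)%:E <=
    ((2 * (2 ^+ k.+1 * expR (- (c / 4)))) `^ p / c ^+ 2)%:E *
      plane_int (disc_kernel (6 * c + 1) (3 * c) (on_disc rad (wp k.+1 g)) z) +
    C%:E * plane_int (disc_kernel (6 * c + 1) (3 * c + 1) (wp k (g^`()%classic)) z))%E.
Proof.
move=> c1; have c0 : 0 < c by lra.
have c30 : 0 <= 3 * c by lra.
have [C C0 HC] := weighted_local_le k c30 p0.
set A : R := 2 ^+ k.+1 * expR (- (c / 4)).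
have A0 : 0 < A by rewrite mulr_gt0 ?exprn_gt0 ?expR_gt0.
pose B : R := 3 * c * 3 ^+ k * expR (9 * c).
have B0 : 0 < B by apply: mulr_gt0 (expR_gt0 _); apply: mulr_gt0 (exprn_gt0 _ _); lra.
exists ((2 * B) `^ p * C); first by rewrite mulr_ge0 ?powR_ge0 ?ltW.
move=> g rad z eg; have eg' := entire_derive1 eg.
set rho := 6 * c + 1; set U := on_disc rad (wp k.+1 g).
have U0 w : 0 <= U w by apply: on_disc_ge0 => w'; exact: weighted_pow_ge0.
have mU : plane_measurable U by exact: on_disc_measurable (weighted_pow_measurable p k.+1 eg).
have K10 : (0 <= plane_int (disc_kernel rho (3 * c) U z))%E.
  by apply: plane_int_ge0 => w; exact: disc_kernel_ge0.
have K20 : (0 <= plane_int (disc_kernel rho (3 * c + 1) (wp k (g^`()%classic)) z))%E.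
  by apply: plane_int_ge0 => w; apply: disc_kernel_ge0 => w'; exact: weighted_pow_ge0.
have P1 : 0 <= (2 * A) `^ p / c ^+ 2 by rewrite divr_ge0 ?powR_ge0 ?sqr_ge0.
have P2 : 0 <= (2 * B) `^ p * C by rewrite mulr_ge0 ?powR_ge0 ?ltW.
have trivial0 : (0 <= ((2 * A) `^ p / c ^+ 2)%:E * plane_int (disc_kernel rho (3 * c) U z) +
    ((2 * B) `^ p * C)%:E *
    plane_int (disc_kernel rho (3 * c + 1) (wp k (g^`()%classic)) z))%E.
  by apply: adde_ge0; apply: mule_ge0; rewrite ?lee_fin.
rewrite /off_disc; case: ifP => // zrho.
rewrite {1}/U /on_disc; case: ifP => // zrad.
have zc : 6 * c <= 1 + Nc z by move: zrho c0; rewrite /rho; clear; lra.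
have z1 : 1 <= Nc z by move: zrho c0; rewrite /rho; clear; lra.
have rho2 : 2 * (3 * c + 1) <= 1 + rho by rewrite /rho; clear; lra.
have [v vz Hv] := @weighted_primitive_le _ k g z c eg c0 zc z1.
have Nz0 := normc_1D_gt0 z.
have X0 := weighted_ge0 k.+1 g z; have Y0 := weighted_ge0 k (g^`()%classic) v.
rewrite -/A -/B in Hv; rewrite /weighted_pow.
have [XB|XB] := leP (weighted k.+1 g z) (2 * B * weighted k (g^`()%classic) v).
  apply: (@le_trans _ _ (((2 * B) `^ p * C)%:E *
    plane_int (disc_kernel rho (3 * c + 1) (wp k (g^`()%classic)) z))%E); last first.
    by rewrite leeDr // mule_ge0 // lee_fin.
  apply: (@le_trans _ _ ((2 * B * weighted k (g^`()%classic) v) `^ p)%:E).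
    by rewrite lee_fin; exact: ler_powR_nneg.
  rewrite powRM ?(ltW (mulr_gt0 (ltr0Sn R 1) B0)) // !EFinM -muleA.
  apply: lee_wpmul2l; first by rewrite lee_fin powR_ge0.
  exact: (HC rho _ z v eg' rho2 zrho vz).
apply: (@le_trans _ _ (((2 * A) `^ p / c ^+ 2)%:E * plane_int (disc_kernel rho (3 * c) U z))%E);
  last by rewrite leeDl // mule_ge0 // lee_fin.
set d := c / (1 + Nc z); have d0 : 0 < d by rewrite divr_gt0.
pose z' := z - (2 * c / (1 + Nc z) / Nc z)%:C * z.
have mK := disc_kernel_measurable_l rho (3 * c) z mU.
have Xp0 : 0 <= weighted k.+1 g z `^ p := powR_ge0 _ _.
have mD := plane_measurable_disc z' d (plane_measurable_cst (weighted k.+1 g z `^ p)).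
have s0 : 0 <= (1 + Nc z) ^+ 2 / c ^+ 2 by rewrite divr_ge0 ?sqr_ge0.
have -> : weighted k.+1 g z `^ p =
    (1 + Nc z) ^+ 2 / c ^+ 2 * (weighted k.+1 g z `^ p * d ^+ 2).
  by move: (_ `^ p) => y; rewrite /d; field; rewrite !gt_eqF.
rewrite EFinM; apply: le_trans (lee_wpmul2l _ (plane_int_disc_ge z' (ltW d0) Xp0)) _.
  by rewrite lee_fin.
rewrite -(plane_intZ mK P1); last by move=> w; exact: disc_kernel_ge0.
rewrite -(plane_intZ mD s0); last by move=> w; case: ifP.
apply: le_plane_int.
- exact: plane_measurableM (plane_measurable_cst _) mD.
- exact: plane_measurableM (plane_measurable_cst _) mK.
move=> w; have KK : 0 <= (2 * A) `^ p / c ^+ 2 * disc_kernel rho (3 * c) U z w.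
  by rewrite mulr_ge0 // disc_kernel_ge0.
case: ifP => wz'; last by rewrite mulr0 lexx.
rewrite mulr_ge0 //=.
have [wz win] := @inward_disc _ z w c c0 zc z1 wz'.
have wrad : Nc w <= rad by apply: le_trans win (le_trans _ zrad); rewrite gerBl ltW.
rewrite /disc_kernel zrho wz /= /U /on_disc wrad.
have -> : (2 * A) `^ p / c ^+ 2 * ((1 + Nc z) ^+ 2 * wp k.+1 g w) =
    (1 + Nc z) ^+ 2 / c ^+ 2 * ((2 * A) `^ p * wp k.+1 g w).
  by move: ((2 * A) `^ p) (wp _ _ _) => x y; field; rewrite gt_eqF.
apply: ler_wpM2l => //.
rewrite /weighted_pow -powRM ?weighted_ge0 ?(ltW (mulr_gt0 (ltr0Sn R 1) A0)) //.
apply: ler_powR_nneg => //.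
have := Hv w wz win; move: XB; rewrite -!mulrA; clear; lra.
Qed.

(** The mass of [weighted k.+1 g] in the disc of radius [rad] is at most half of
    itself plus a bound independent of [rad]; being finite, it can be absorbed. *)
Lemma weighted_pow_primitive_lty k g : entire g ->
  (plane_int (wp k (g^`()%classic)) < +oo)%E -> (plane_int (wp k.+1 g) < +oo)%E.
Proof.
move=> eg Ig'; have eg' := entire_derive1 eg.
have mg := weighted_pow_measurable p k.+1 eg; have mg' := weighted_pow_measurable p k eg'.
(* [64 (3 c)^2 = 576 c^2] is the bound of disc_kernel_int_le for a = 3 c, and the
   area of the inward disc gives back the factor c^2. *)
have K0 : 0 <= 576 * (2 * 2 ^+ k.+1) `^ p :> R := mulr_ge0 (ler0n _ 576) (powR_ge0 _ _).
have [c c1 cK] := large_shift K0.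
have [C C0 HC] := weighted_pow_primitive_kernel_le k c1.
set A := (2 * (2 ^+ k.+1 * expR (- (c / 4)))) `^ p in HC.
have A0 : 0 <= A by exact: powR_ge0.
have Ahalf : A / c ^+ 2 * (64 * (3 * c) ^+ 2) <= 1 / 2.
  have -> : A / c ^+ 2 * (64 * (3 * c) ^+ 2) = 576 * A by field; rewrite gt_eqF //; lra.
  apply: le_trans cK; rewrite /A mulrA powRM ?expR_ge0 ?mulr_ge0 ?exprn_ge0 //.
  by rewrite mulrA.
set rho := 6 * c + 1 in HC.
have rho0 : 0 <= rho by rewrite /rho; lra.
pose L := (C * (64 * (3 * c + 1) ^+ 2))%:E.
pose Bd := ((plane_int (on_disc rho (wp k.+1 g)) + L * plane_int (wp k (g^`()%classic))) * 2%:E)%E.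
have Q0 : (0 <= plane_int (wp k (g^`()%classic)))%E.
  by apply: plane_int_ge0 => z; exact: weighted_pow_ge0.
have L0 : (0 <= L)%E by rewrite lee_fin mulr_ge0 // mulr_ge0 // sqr_ge0.
have I0 : (0 <= plane_int (on_disc rho (wp k.+1 g)))%E.
  by apply: plane_int_ge0 => z; apply: on_disc_ge0 => w; exact: weighted_pow_ge0.
have Ifin := on_disc_weighted_pow_lty p0 k.+1 rho0 eg.
have LQ : (L * plane_int (wp k (g^`()%classic)) < +oo)%E by rewrite lte_mul_pinfty.
have Bdfin : (Bd < +oo)%E.
  have S0 := adde_ge0 I0 (mule_ge0 L0 Q0).
  have Sfin := lte_add_pinfty Ifin LQ.
  by apply: lte_mul_pinfty => //; [rewrite ge0_fin_numE|exact: ltry].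
apply: le_lt_trans Bdfin; apply: (plane_int_exhaust mg (weighted_pow_ge0 _ _ _)) => n.
set U := on_disc n%:R (wp k.+1 g).
have mU : plane_measurable U := on_disc_measurable n%:R mg.
have U0 z : 0 <= U z by apply: on_disc_ge0 => w; exact: weighted_pow_ge0.
have Ufin : (plane_int U < +oo)%E by exact: on_disc_weighted_pow_lty.
have UI0 : (0 <= plane_int U)%E by exact: plane_int_ge0.
have Uoff : (plane_int (off_disc rho U) <= (1 / 2)%:E * plane_int U + L * plane_int (wp k (g^`()%classic)))%E.
  apply: le_trans (@le_disc_kernel_int _ (off_disc rho U) (A / c ^+ 2) C rho (3 * c) (3 * c + 1)
    U (wp k (g^`()%classic)) _ _ _ _ _ _ _ _ _ _ _ _ (fun z => HC g n%:R z eg)) _ => //.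
  - by rewrite divr_ge0 // sqr_ge0.
  - lra.
  - lra.
  - by rewrite /rho; lra.
  - by rewrite /rho; lra.
  - exact: (off_disc_measurable rho mU).
  - by move=> z; exact: off_disc_ge0.
  - by move=> z; exact: weighted_pow_ge0.
  apply: leeD => //; apply: lee_wpmul2r => //.
have Uon : (plane_int (on_disc rho U) <= plane_int (on_disc rho (wp k.+1 g)))%E.
  apply: le_plane_int; [exact: (on_disc_measurable rho mU)|exact: (on_disc_measurable rho mg)|move=> z].
  rewrite on_disc_ge0 //= /on_disc /U /on_disc; case: ifP => // _; case: ifP => // _.
  exact: weighted_pow_ge0.
have := le_trans (plane_int_le_on_off rho mU U0) (leeD Uon Uoff).
have fU : plane_int U \is a fin_num by rewrite ge0_fin_numE.
have fI : plane_int (on_disc rho (wp k.+1 g)) \is a fin_num by rewrite ge0_fin_numE.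
have fQ : (L * plane_int (wp k (g^`()%classic)))%E \is a fin_num.
  by rewrite ge0_fin_numE // mule_ge0.
rewrite /Bd -(fineK fU) -(fineK fI) -(fineK fQ) -!EFinM -!EFinD !lee_fin.
move: (fine _) (fine _) (fine _) => x y t; lra.
Qed.

End PrimitiveIntegral.

(** * The case of infinite exponent *)

Section SupCase.
Context {R : realType}.
Implicit Types (z w v : R[i]) (k : nat) (g : R[i] -> R[i]).

Lemma weighted_derive_bounded k g : entire g ->
  (exists M, forall z, weighted k.+1 g z <= M) ->
  exists M, forall z, weighted k (g^`()%classic) z <= M.
Proof.
move=> eg [M HM]; have eg' := entire_derive1 eg.
have [c _ cmax] := disc_max 0 ler01 (@continuous_weighted _ k _ eg').
pose D : R := 2 * 3 ^+ k.+1 * expR 3.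
have D0 : 0 <= D by rewrite !mulr_ge0 ?exprn_ge0 ?expR_ge0.
exists (Num.max (weighted k (g^`()%classic) c) (D * M)) => z; rewrite le_max.
have [z1|z1] := leP (Nc z) 1; first by rewrite cmax // subr0.
have z2 : 2 <= 1 + Nc z by lra.
have [v _ Hv] := weighted_derive_le k eg z2.
by apply/orP; right; apply: le_trans Hv _; rewrite -/D; exact: ler_wpM2l.
Qed.

(** The absorption argument for suprema: on a large disc, a maximum attained far
    from the origin is at most half of itself plus a multiple of the bound on
    the derivative. *)
Lemma weighted_primitive_bounded k g : entire g ->
  (exists M, forall z, weighted k (g^`()%classic) z <= M) ->
  exists M, forall z, weighted k.+1 g z <= M.
Proof.
move=> eg [M HM].
have K0 : 0 <= 2 ^+ k.+1 :> R by rewrite exprn_ge0.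
have [c c1 cK] := large_shift (@ltr01 R) K0; rewrite powRr1 ?expR_ge0 // in cK.
have c0 : 0 < c by lra.
have rho0 : 0 <= 6 * c + 1 by lra.
have [u _ umax] := disc_max 0 rho0 (@continuous_weighted _ k.+1 g eg).
pose B : R := 3 * c * 3 ^+ k * expR (9 * c).
have B0 : 0 <= B by apply: mulr_ge0 (expR_ge0 _); apply: mulr_ge0 (exprn_ge0 _ _); lra.
exists (Num.max (weighted k.+1 g u) (2 * (B * M))) => z; rewrite le_max.
have [z1 z1r zmax] := disc_max 0 (normc_ge0 z) (@continuous_weighted _ k.+1 g eg).
rewrite subr0 in z1r.
have zz1 : weighted k.+1 g z <= weighted k.+1 g z1 by apply: zmax; rewrite subr0.
have [z1rho|z1rho] := leP (Nc z1) (6 * c + 1).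
  by rewrite (le_trans zz1) // umax // subr0.
have zc : 6 * c <= 1 + Nc z1 by lra.
have z11 : 1 <= Nc z1 by lra.
have [v _ Hv] := weighted_primitive_le k eg c0 zc z11.
pose w := z1 - (2 * c / (1 + Nc z1) / Nc z1)%:C * z1.
have d0 : 0 <= c / (1 + Nc z1) by rewrite divr_ge0 ?ltW // normc_1D_gt0.
have [wz win] : Nc (w - z1) <= 3 * c / (1 + Nc z1) /\ Nc w <= Nc z1 - c / (1 + Nc z1).
  by apply: inward_disc => //; rewrite subrr Normc.normc0.
have ww : weighted k.+1 g w <= weighted k.+1 g z1.
  by apply: zmax; rewrite subr0; move: win z1r d0; lra.
have half : 2 ^+ k.+1 * expR (- (c / 4)) * weighted k.+1 g w <= 1 / 2 * weighted k.+1 g z1.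
  by apply: ler_pM ww => //; rewrite ?weighted_ge0 // mulr_ge0 // expR_ge0.
have BM : B * weighted k (g^`()%classic) v <= B * M by rewrite ler_wpM2l.
have := Hv w wz win; rewrite -/B => Hw; apply/orP; right.
by apply: le_trans zz1 _; move: Hw half BM; clear; lra.
Qed.

End SupCase.

(** * Membership in the Fock space *)

Section FiniteNorm.
Context {R : realType}.
Local Notation plane := (measurableTypeR R * measurableTypeR R)%type.
Implicit Types (k : nat) (g : R[i] -> R[i]) (h : R[i] -> R).

Lemma finite_norm_powP (r : R) h : 0 < r -> (forall z, 0 <= h z) ->
  finite_norm (@area R) r%:E (fun w : plane => h (of_plane w)) <->
  (plane_int (fun z => (h z `^ r)%R) < +oo)%E.
Proof.
move=> r0 h0; rewrite /finite_norm.
have E : (\int[@area R]_w (`|(EFin \o (fun w : plane => h (of_plane w))) w| `^ r) =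
          plane_int (fun z => (h z `^ r)%R))%E.
  by apply: eq_integral => w _ /=; rewrite ger0_norm.
have := @powR_Lnorm _ _ _ (@area R) (EFin \o (fun w : plane => h (of_plane w))) r (lt0r_neq0 r0).
rewrite E => NE; split=> [Nfin|Ifin].
  by rewrite -NE; exact: poweR_lty.
by rewrite unlock E; exact: poweR_lty.
Qed.

Lemma area_setT_gt0 : (0 < @area R [set: plane])%E.
Proof.
have := @area_square R 0 0 1 ler01; rewrite expr1n => sq.
apply: lt_le_trans (_ : (0 < 1%:E)%E) _; first exact: lte01.
by rewrite -sq; apply: le_measure; rewrite ?inE //; apply: measurableX; exact: measurable_itv.
Qed.

(** A continuous function that exceeds M somewhere does so on a square, which is
    not negligible. *)
Lemma finite_norm_infP h : continuous h -> (forall z, 0 <= h z) ->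
  finite_norm (@area R) +oo%E (fun w : plane => h (of_plane w)) <->
  exists M, forall z, h z <= M.
Proof.
move=> ch h0; rewrite /finite_norm unlock area_setT_gt0; split; last first.
  move=> [M HM]; apply: le_lt_trans (ltry M).
  apply/ess_supP/nearW => w /=; rewrite lee_fin ger0_norm //; exact: HM.
move=> Nfin.
have [M NM] : exists M : R, (ess_sup (@area R) (abse \o (EFin \o (fun w : plane => h (of_plane w)))) <= M%:E)%E.
  move: Nfin; case: (ess_sup _ _) => [M| |] // _; first by exists M.
  by exists 0; rewrite leNye.
move/ess_supP: NM => [A [mA A0 HA]].
exists M => z; rewrite leNgt; apply/negP => Mz.
have e0 : 0 < h z - M by rewrite subr_gt0.
have [d d0 Hd] := (continuous_real_normcP h z).1 (ch z) _ e0.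
pose l := d / 4; have l0 : 0 < l by rewrite divr_gt0.
pose S : set plane := `[complex.Re z, complex.Re z + l]%classic `*` `[complex.Im z, complex.Im z + l]%classic.
have mS : measurable S by apply: measurableX; exact: measurable_itv.
have SA : S `<=` A.
  move=> [x y] [/= ]; rewrite !in_itv /= => /andP [x1 x2] /andP [y1 y2].
  apply: HA => /=; rewrite lee_fin ger0_norm // => hM.
  have := Hd (x +i* y) _; rewrite ltr_norml => /(_ _)/andP [|+ _].
    apply: le_lt_trans (normc_le_ReIm _) _ => /=.
    case: (z) x1 x2 y1 y2 => a b /= x1 x2 y1 y2.
    rewrite !ger0_norm ?subr_ge0 //; rewrite /l in l0 x2 y2; lra.
  by move: hM; rewrite /of_plane /=; lra.
have : (@area R S <= @area R A)%E by apply: le_measure; rewrite ?inE.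
have -> : @area R S = (l ^+ 2)%:E := area_square _ _ (ltW l0).
by rewrite A0; apply/negP; rewrite -ltNge lte_fin exprn_gt0.
Qed.

End FiniteNorm.

(** * Trading derivatives for powers *)

Section FockSpaces.
Context {R : realType}.
Implicit Types (p : \bar R) (k m : nat) (f g : R[i] -> R[i]).

(** Finiteness of the L^p norm of g with weight [(1 + |z|)^k exp (- |z|^2 / 2)],
    with the integral or the supremum in place of the norm; the value at -oo is
    arbitrary. *)
Definition weighted_finite p k g : Prop :=
  match p with
  | r%:E => (plane_int (weighted_pow r k g) < +oo)%E
  | +oo%E => exists M, forall z, weighted k g z <= M
  | -oo%E => True
  end.

(** One derivative is worth one power of [1 + |z|]. *)
Lemma weighted_finite_derive p k g : (0 < p)%E -> entire g ->
  weighted_finite p k (g^`()%classic) <-> weighted_finite p k.+1 g.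
Proof.
case: p => [r| |] p0 eg; last by [].
  by split; [exact: (weighted_pow_primitive_lty (p := r))|exact: (weighted_pow_derive_lty (p := r))].
by split; [exact: weighted_primitive_bounded|exact: weighted_derive_bounded].
Qed.

Lemma weighted_finite_derive1n p m k f : (0 < p)%E -> entire f ->
  weighted_finite p k (f^`(m)%classic) <-> weighted_finite p (k + m) f.
Proof.
move=> p0 ef; elim: m k => [|m ih] k; first by rewrite addn0.
rewrite derive1nS addnS -addSn; apply: (iff_trans _ (ih k.+1)).
exact: (weighted_finite_derive k p0 (entire_derive1n (m := m) ef)).
Qed.

Lemma weighted0E g z :
  Nc (g z * (expR (- (Nc z ^+ 2 / 2)))%:C) = weighted 0 g z.
Proof.
rewrite Normc.normcM normc_real ger0_norm ?expR_ge0 //.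
by rewrite /weighted /fock_weight expr0 mul1r mulrC.
Qed.

Lemma Fock_weighted_finite p g : (0 < p)%E -> entire g ->
  Fock p g <-> weighted_finite p 0 g.
Proof.
move=> p0 eg; pose G z := g z * (expR (- (Nc z ^+ 2 / 2)))%:C.
have cW := @continuous_fock_weight R 0; have cg := entire_continuous eg.
have GE z : G z = g z * (fock_weight 0 z)%:C by rewrite /G /fock_weight expr0 mul1r.
have mRe : plane_measurable (fun z => complex.Re (G z)).
  have -> : (fun z => complex.Re (G z)) = (fun z => complex.Re (g z) * fock_weight 0 z).
    by apply/funext => z; rewrite GE; case: (g z) => x y /=; rewrite mulr0 subr0.
  apply: continuous_plane_measurable => z.
  apply: (@continuousM R R[i] (fun z => complex.Re (g z)) (fock_weight 0) z _ (cW z)).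
  exact: (continuous_comp (cg z) (@continuous_Re R (g z))).
have mIm : plane_measurable (fun z => complex.Im (G z)).
  have -> : (fun z => complex.Im (G z)) = (fun z => complex.Im (g z) * fock_weight 0 z).
    by apply/funext => z; rewrite GE; case: (g z) => x y /=; rewrite mulr0 add0r.
  apply: continuous_plane_measurable => z.
  apply: (@continuousM R R[i] (fun z => complex.Im (g z)) (fock_weight 0) z _ (cW z)).
  exact: (continuous_comp (cg z) (@continuous_Im R (g z))).
have NE : (fun w => Nc (G (of_plane w))) = (fun w => weighted 0 g (of_plane w)).
  by apply/funext => w; exact: weighted0E.
have cw := @continuous_weighted _ 0 g eg.
have w0 := weighted_ge0 0 g.
have NP : finite_norm (@area R) p (fun w => Nc (G (of_plane w))) <-> weighted_finite p 0 g.
  rewrite NE; case: p p0 => [r| |] p0; last by [].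
    exact: (finite_norm_powP p0 w0).
  exact: (finite_norm_infP cw w0).
split=> [[_ [_ _ /NP]] //|/NP H].
split; first exact: eg.
by split; [exact: mRe|exact: mIm|exact: H].
Qed.

Lemma entire_mulXn m f : entire f -> entire (fun z => z ^+ m * f z).
Proof.
move=> ef z.
have dX n : exists d, is_derive z 1 (fun w : R[i] => w ^+ n) d.
  elim: n => [|n [d ih]].
    have -> : (fun w : R[i] => w ^+ 0) = cst 1 by apply/funext => w; rewrite expr0.
    by exists 0; exact: is_derive_cst.
  have id1 : is_derive z 1 (@id R[i]) 1 by exact: is_derive_id.
  exists (1 * z ^+ n + z * d).
  have -> : (fun w : R[i] => w ^+ n.+1) = (fun w => w * w ^+ n).
    by apply/funext => w; rewrite exprS.
  exact: is_derive_mulC.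
have [d dz] := dX m.
by have [] := is_derive_mulC dz (entire_is_derive ef z).
Qed.

Lemma weighted_expR m f z :
  weighted m f z = expR (- (Nc z ^+ 2 / 2)) * ((1 + Nc z) ^+ m * Nc (f z)).
Proof. by rewrite /weighted /fock_weight; ring. Qed.

Lemma weighted_mulXn m f z :
  weighted 0 (fun w => w ^+ m * f w) z = expR (- (Nc z ^+ 2 / 2)) * (Nc z ^+ m * Nc (f z)).
Proof. by rewrite /weighted /fock_weight expr0 mul1r Normc.normcM normcX. Qed.

Lemma weighted_mulXn_le m f z : weighted 0 (fun w => w ^+ m * f w) z <= weighted m f z.
Proof.
rewrite weighted_mulXn weighted_expR.
rewrite ler_wpM2l ?expR_ge0 // ler_wpM2r ?normc_ge0 // lerXn2r ?nnegrE ?normc_ge0 //.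
  by rewrite addr_ge0 // normc_ge0.
by rewrite lerDr.
Qed.

Lemma weighted_le_mulXn m f z : 1 <= Nc z ->
  weighted m f z <= 2 ^+ m * weighted 0 (fun w => w ^+ m * f w) z.
Proof.
move=> z1; rewrite weighted_mulXn weighted_expR (mulrCA (2 ^+ m)).
rewrite ler_wpM2l ?expR_ge0 // mulrA -exprMn ler_wpM2r ?normc_ge0 //.
rewrite lerXn2r ?nnegrE ?mulr_ge0 ?addr_ge0 ?normc_ge0 //.
by rewrite mulr_natl mulr2n lerD2r.
Qed.

(** The weights [|z|^m] and [(1 + |z|)^m] are comparable off the unit disc. *)
Lemma weighted_finite_mulXn p m f : (0 < p)%E -> entire f ->
  weighted_finite p m f <-> weighted_finite p 0 (fun z => z ^+ m * f z).
Proof.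
move=> p0 ef; have eX := entire_mulXn (m := m) ef.
case: p p0 => [r| |] r0; [split|split|by []].
- apply: le_lt_trans; apply: le_plane_int; [exact: (weighted_pow_measurable r 0 eX)|exact: (weighted_pow_measurable r m ef)|].
  move=> z; rewrite weighted_pow_ge0 /=; apply: ler_powR_nneg => //; first exact: weighted_ge0.
  exact: weighted_mulXn_le.
- move=> IX; have mf := weighted_pow_measurable r m ef; have mX := weighted_pow_measurable r 0 eX.
  apply: le_lt_trans (plane_int_le_on_off 1 mf (weighted_pow_ge0 _ _ _)) _.
  rewrite lte_add_pinfty ?on_disc_weighted_pow_lty //.
  have C0 : 0 <= (2 ^+ m) `^ r :> R by exact: powR_ge0.
  have I0 : (0 <= plane_int (weighted_pow r 0 (fun z => (z ^+ m * f z)%R)))%E.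
    by apply: plane_int_ge0 => z; exact: weighted_pow_ge0.
  apply: (@le_lt_trans _ _ (((2 ^+ m) `^ r)%:E * plane_int (weighted_pow r 0 (fun z => (z ^+ m * f z)%R)))%E); last first.
    by rewrite lte_mul_pinfty.
  rewrite -plane_intZ //; last by move=> z; exact: weighted_pow_ge0.
  apply: le_plane_int.
  - exact: (off_disc_measurable 1 mf).
  - exact: (plane_measurableM (plane_measurable_cst _) mX).
  move=> z; rewrite off_disc_ge0 /=; last by move=> w; exact: weighted_pow_ge0.
  rewrite /off_disc; case: ifP => z1; last by rewrite mulr_ge0 // weighted_pow_ge0.
  rewrite /weighted_pow -powRM ?weighted_ge0 ?exprn_ge0 //.
  by apply: ler_powR_nneg; rewrite ?weighted_ge0 ?weighted_le_mulXn.
- move=> [M HM]; exists M => z; exact: le_trans (weighted_mulXn_le _ _ _) (HM z).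
move=> [M HM]; have [c _ cmax] := disc_max 0 ler01 (@continuous_weighted _ m f ef).
exists (Num.max (weighted m f c) (2 ^+ m * M)) => z; rewrite le_max.
have [z1|z1] := leP (Nc z) 1; first by rewrite cmax // subr0.
apply/orP; right; apply: le_trans (weighted_le_mulXn _ _ (ltW z1)) _.
by apply: ler_wpM2l => //; exact: exprn_ge0.
Qed.

End FockSpaces.

Theorem theoremA (R : realType) (p : \bar R) (m : nat) (f : R[i] -> R[i])
    (p_gt0 : (0 < p)%E) (m_gt0 : (0 < m)%N) (f_entire : entire f) :
  Fock_Sobolev p m f <-> Fock p (fun z : R[i] => z ^+ m * f z).
Proof.
have efm := entire_derive1n (m := m) f_entire; have eX := entire_mulXn (m := m) f_entire.
apply: iff_trans (_ : Fock p (f^`(m)%classic) <-> _).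
  by split=> [[]|].
apply: iff_trans (Fock_weighted_finite p_gt0 efm) _.
apply: iff_trans (weighted_finite_derive1n m 0 p_gt0 f_entire) _.
apply: iff_trans (weighted_finite_mulXn m p_gt0 f_entire) _.
exact: iff_sym (Fock_weighted_finite p_gt0 eX).
Qed.
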